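(* Let $G$ be a finitely presented group. Let $\mathcal{M}$ be the $\mathbb{Z}_2$-vector space freely generated by all two-component free links. For a one-component $G$-graph $\gamma$ with labeling $l$ and a vertex $c$ of $\gamma$, let $\gamma_c\in\mathcal{M}$ be the two-component free link represented by the oriented smoothing of $\gamma$ at $c$ (forgetting labels and source-sink structure). For $g\in G$, $g\neq 1$, put $$\Delta_g(\gamma)=\sum_{c:\ l(c)\in\{g,g^{-1}\}}\gamma_c\in\mathcal{M},\qquad \Delta_G(\gamma)=\sum_{c:\ l(c)\neq 1}\gamma_c\in\mathcal{M}.$$ Then for each $g\in G$, $g\ne 1$, the mapping $\Delta_g$ is invariant, i.e. if $\gamma$ and $\gamma'$ are one-component $G$-graphs representing the same $G$-knot, then $\Delta_g(\gamma)=\Delta_g(\gamma')$. Consequently, $\Delta_G$ is an invariant mapping, i.e. $\Delta_G(\gamma)=\Delta_G(\gamma')$.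
   Context: Framed 4-graphs. A 4-graph is a finite 4-valent graph (loops and multiple edges allowed), possibly together with finitely many circular components (circles without vertices, disjoint from the rest). It is framed if at every vertex the four half-edges are split into two pairs; half-edges in the same pair are called opposite, half-edges at the vertex which are not opposite are called adjacent. A unicursal component is an equivalence class of edges under the relation generated by being opposite at some vertex. The number of components is the number of circular components plus the number of unicursal components. A source-sink structure is an orientation of all edges such that at every vertex the two half-edges of one opposite pair are emanating and the two half-edges of the other opposite pair are incoming (circular components are just assumed oriented). $G$-graphs. A $G$-graph is a framed 4-graph with a chosen source-sink structure and a map (labeling) from its set of vertices to $G$. Graphs are considered up to isomorphism preserving all the structure. Reidemeister moves on $G$-graphs (everything outside the described fragment, including the edge orientations, is unchanged). R1: if a vertex $X$ labeled $1$ carries a loop whose two half-edges are adjacent at $X$, delete $X$ and the loop and join the other two half-edges at $X$ into one edge; or the inverse operation. R2: if distinct vertices $v,w$ with mutually inverse labels are connected by two edges $e_1,e_2$ that are non-opposite at $v$ and at $w$, delete $v,w,e_1,e_2$, and for $i=1,2$ join the half-edge opposite to $e_i$ at $v$ with the half-edge opposite to $e_i$ at $w$; or the inverse operation. R3: suppose distinct vertices $A,B,C$ labeled $a,b,c$ are connected by edges $A\to B$, $B\to C$, $C\to A$ (oriented by the source-sink structure), any two of them sharing a vertex being non-opposite there, and $a\cdot b\cdot c=1$. This fragment consists of three strands: strand 1 passes through $A$ then $B$, strand 2 through $B$ then $C$, strand 3 through $C$ then $A$, each entering and leaving through the outer half-edges opposite to the corresponding triangle edge. Replace $A,B,C$ by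 vertices $A',B',C'$ (crossings of the same pairs of strands as $A,B,C$) labeled $a^{-1},b^{-1},c^{-1}$, with the order of the two vertices on each strand reversed (outer ends of the strands unchanged; two half-edges at a new vertex are opposite if they lie on the same strand; the triangle edges receive the orientation making a source-sink structure). A $G$-free link is an equivalence class of $G$-graphs under R1, R2, R3; a $G$-knot is a one-component $G$-free link. A free link is an equivalence class of framed 4-graphs (without labels and without source-sink structure) under the same three moves with all conditions on labels and source-sink orientations dropped. The number of components is preserved by the moves. Oriented smoothing. Let $\gamma$ be a one-component framed 4-graph and $c$ a vertex. Orient the single unicursal component by traversing it (going from each half-edge to the opposite one at every vertex). At $c$ two half-edges are then incoming and two outgoing. The oriented smoothing at $c$ deletes $c$ and joins each incoming half-edge to the outgoing half-edge not opposite to it. The result is a framed 4-graph with two components (circular components counted), independent of the choice of traversal direction. *)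

(* Defs.v *)
From HB Require Import structures.
From Stdlib Require Import Relation_Operators.
From mathcomp Require Import all_boot all_algebra fingroup perm.
From mathcomp Require Import boolp classical_sets.
From mathcomp Require Import monalg.

Set Implicit Arguments.
Unset Strict Implicit.
Unset Printing Implicit Defensive.

Local Open Scope nat_scope.

(* Graphs are only considered up to isomorphism, so the vertex set is 'I_n.
   The four half-edges at v are (v, p, s) with p, s : bool; p tells which of
   the two pairs of opposite half-edges (v, p, s) belongs to, so 4-valence and
   the framing are built into the type. *)
Definition hedge (n : nat) : Type := ('I_n * bool * bool)%type.

HB.instance Definition _ n := Finite.on (hedge n).

Definition vtx n (h : hedge n) : 'I_n := h.1.1.
Definition opp n (h : hedge n) : hedge n := (h.1, ~~ h.2).

(* The edges are the pairs {h, mate h}; loops and multiple edges may occur.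
   ncirc is the number of circular components. *)
Record fgraph : Type := FGraph {
  nvert : nat;
  mate : hedge nvert -> hedge nvert;
  ncirc : nat;
  mateK : involutive mate;
  mate_neq : forall h, mate h != h
}.

Notation half_edge X := (hedge (nvert X)).

Definition adjacent n (h k : hedge n) : bool :=
  [&& vtx h == vtx k, h != k & k != opp h].

(* Edges being mate-orbits, the unicursal components are the classes of the
   equivalence relation on half-edges generated by this relation. *)
Definition unicursal (X : fgraph) : rel (half_edge X) :=
  fun h k => (k == mate h) || (k == opp h).

Definition ncomp (X : fgraph) : nat :=
  ncirc X + n_comp (@unicursal X) predT.

(* Every vertex carries half-edges, so the map on half-edges determines the one
   on vertices. *)
Definition is_fiso (X Y : fgraph) (f : half_edge X -> half_edge Y) : Prop :=
  [/\ bijective f,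
      forall h, f (mate h) = mate (f h),
      forall h, f (opp h) = opp (f h),
      forall h k, (vtx (f h) == vtx (f k)) = (vtx h == vtx k)
    & ncirc X = ncirc Y].

Lemma oppK n : involutive (@opp n).
Proof. by case=> [[v p] s]; rewrite /opp /= negbK. Qed.

Lemma opp_neq n (h : hedge n) : opp h != h.
Proof. by case: h => [[v p] []]; apply/eqP; case. Qed.

Lemma vtx_opp n (h : hedge n) : vtx (opp h) = vtx h.
Proof. by []. Qed.

Lemma inv2_sym (T : eqType) (f g : T -> T) : involutive f -> involutive g ->
  symmetric (fun h k => (k == f h) || (k == g h)).
Proof.
move=> fK gK a b; rewrite [a == f b]eq_sym [a == g b]eq_sym.
by rewrite (inv_eq fK) (inv_eq gK).
Qed.

Section Splice.
(* The vertices of S are deleted, and at each of them the half-edges h and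
   J h are joined. *)
Variables (X : fgraph) (S : {set 'I_(nvert X)}).
Variable J : half_edge X -> half_edge X.
Hypotheses (JK : involutive J) (J_neq : forall h, J h != h).
Hypothesis J_vtx : forall h, vtx (J h) = vtx h.

Local Notation H := (half_edge X).

Definition kept (h : H) : bool := vtx h \notin S.

Definition join (h : H) : H := if kept h then h else J h.

Definition step (h : H) : H := mate (join h).

(* The first surviving half-edge met when arriving through h and then
   following the edges and the joins. *)
Definition exit_of (h : H) : option H := ohead [seq k <- orbit step h | kept k].

(* The arcs obtained by joining the edges; those which meet no surviving
   half-edge have closed up into circular components. *)
Definition arc : rel H := fun h k => (k == mate h) || (k == join h).

Definition closed_arcs : {pred H} :=
  [pred h | [forall k, connect arc h k ==> ~~ kept k]].

Definition survivor : Type := {v : 'I_(nvert X) | v \notin S}.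
HB.instance Definition _ := SubFinite.on survivor.

Definition emb (h : hedge #|{: survivor}|) : H :=
  (val (enum_val h.1.1), h.1.2, h.2).

Definition proj (h : H) : option (hedge #|{: survivor}|) :=
  if insub h.1.1 is Some w then Some (enum_rank (w : survivor), h.1.2, h.2)
  else None.

Definition splice_mate (h : hedge #|{: survivor}|) : hedge #|{: survivor}| :=
  odflt h (obind proj (exit_of (mate (emb h)))).

Lemma joinK : involutive join.
Proof.
move=> h; rewrite /join; case: (boolP (kept h)) => [->//|hS].
by rewrite /kept J_vtx -/(kept h) (negbTE hS) JK.
Qed.

Lemma step_inj : injective step.
Proof. exact: inj_comp (inv_inj (@mateK X)) (inv_inj joinK). Qed.

Lemma emb_kept h : kept (emb h).
Proof. exact: (svalP (enum_val h.1.1)). Qed.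

Lemma embK : pcancel emb proj.
Proof. by case=> [[v p] s]; rewrite /proj /emb /= valK enum_valK. Qed.

Lemma emb_inj : injective emb.
Proof. exact: pcan_inj embK. Qed.

Lemma projP h : kept h -> exists2 h', proj h = Some h' & emb h' = h.
Proof.
case: h => [[v p] s] hv; rewrite /proj /=.
case: insubP => [w _ ew|]; last by rewrite (hv : v \notin S).
by eexists; first by []; rewrite /emb /= enum_rankK; congr (_, _, _).
Qed.

Lemma emb_opp h : emb (opp h) = opp (emb h).
Proof. by []. Qed.

Lemma exit_kept h k : exit_of h = Some k -> kept k.
Proof.
rewrite /exit_of; have := mem_filter (fun k => kept k) ^~ (orbit step h).
case: filter => //= a s /(_ a); rewrite mem_head => /esym/andP[ka _] [<-].
by [].
Qed.

Lemma exit_of_kept h : kept h -> exit_of h = Some h.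
Proof.
move=> hk; rewrite /exit_of /orbit -orderSpred /= hk //.
Qed.

Lemma exit_step h : ~~ kept h -> exit_of (step h) = exit_of h.
Proof.
move=> hk; rewrite /exit_of.
have -> : orbit step (step h) = rot 1 (orbit step h).
  rewrite /orbit (_ : fingraph.order step (step h) = fingraph.order step h).
    rewrite -orderSpred rot1_cons trajectSr -iterSr orderSpred.
    by rewrite (iter_order step_inj).
  by apply: eq_card => k; rewrite !inE -(same_fconnect1 step_inj).
by rewrite /orbit -orderSpred rot1_cons filter_rcons /= (negbTE hk).
Qed.

(* As an unordered pair, ends is constant along an arc. *)
Definition ends (h : H) := [:: exit_of h; exit_of (mate h)].

Lemma perm_ends a b : perm_eq (ends a) (ends b) ->
  kept a -> kept b -> a <> b -> exit_of (mate a) = Some b.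
Proof.
move=> eab ka kb ab; have : Some b \in ends a.
  by rewrite (perm_mem eab) inE exit_of_kept ?eqxx.
by rewrite !inE (exit_of_kept ka) => /orP[/eqP[/esym]//|/eqP].
Qed.

Lemma arc_ends a b : connect arc a b -> perm_eq (ends a) (ends b).
Proof.
move=> /connectP[s + ->]; elim: s a => [|c s IHs] a /=; first by rewrite perm_refl.
case/andP=> eac /IHs; apply: perm_trans.
have swap x y : perm_eq [:: x; y] [:: y; x :> option H].
  by rewrite (perm_catC [:: x] [:: y]).
case/orP: eac => /eqP->; first by rewrite /ends mateK swap.
have [ka|ka] := boolP (kept a).
  by rewrite /join ka perm_refl.
have kj : ~~ kept (join a) by rewrite /join (negbTE ka) /kept J_vtx.
rewrite /ends -(exit_step ka) -(exit_step kj) /step joinK.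
by rewrite swap.
Qed.

Lemma arc_sym : connect_sym arc.
Proof. exact/sym_connect_sym/inv2_sym/joinK/mateK. Qed.

Lemma exit_first h k : exit_of h = Some k ->
  exists2 n, iter n step h = k & forall i, i < n -> ~~ kept (iter i step h).
Proof.
rewrite /exit_of /orbit; move: (fingraph.order step h) => m.
elim: m h => //= m IHm h.
case: ifP => [_ [<-]|/negbT hk /IHm[n en nk]]; first by exists 0.
exists n.+1 => [|[|i] //]; first by rewrite iterSr.
by rewrite ltnS iterSr => /nk.
Qed.

Lemma exit_mate_ex h : kept h -> exists k, exit_of (mate h) = Some k.
Proof.
move=> hk; have : h \in [seq k <- orbit step (step h) | kept k].
  by rewrite mem_filter hk -fconnect_orbit (fconnect_sym step_inj) fconnect1.
rewrite /step /join hk /exit_of.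
by case: filter => // a s _; exists a.
Qed.

Lemma exit_mate_neq h : kept h -> exit_of (mate h) <> Some h.
Proof.
move=> hk /exit_first[n].
pose x i := iter i step (mate h); rewrite -/(x n) => xn xk.
have xS i : x i.+1 = mate (join (x i)) by [].
have sym i : i <= n -> mate (x (n - i)) = x i.
  elim: i => [|i IHi] lin; first by rewrite subn0 xn.
  have := IHi (ltnW lin); rewrite -(subnSK lin) xS mateK => ej.
  by rewrite xS -ej joinK.
have := odd_double_half n; case: (odd n) => /= en.
  have lmn : n./2 < n by rewrite -[X in _ < X]en add1n ltnS -addnn leq_addr.
  have := sym _ lmn; rewrite xS.
  have -> : n - n./2.+1 = n./2.
    by rewrite -[X in X - _]en add1n subSS -addnn addnK.
  move/(inv_inj (@mateK X))/esym/eqP; rewrite /join (negbTE (xk _ lmn)).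
  by rewrite (negbTE (J_neq _)).
have lmn : n./2 <= n by rewrite -[X in _ <= X]en add0n -addnn leq_addr.
have := sym _ lmn; have -> : n - n./2 = n./2.
  by rewrite -[X in X - _]en add0n -addnn addnK.
by move/eqP; rewrite (negbTE (mate_neq _)).
Qed.

Lemma exit_connect h k : exit_of h = Some k -> connect arc h k.
Proof.
case/exit_first=> n <- _; elim: n => //= n /connect_trans; apply.
apply: (@connect_trans _ _ (join (iter n step h))).
  by apply: connect1; rewrite /arc eqxx orbT.
by apply: connect1; rewrite /arc eqxx.
Qed.

Lemma mate_exit_connect h k : exit_of (mate h) = Some k -> connect arc h k.
Proof.
by move/exit_connect; apply: connect_trans; apply: connect1; rewrite /arc eqxx.
Qed.

Lemma exit_mateK h k : kept h ->
  exit_of (mate h) = Some k -> exit_of (mate k) = Some h.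
Proof.
move=> hk ek; apply: perm_ends => //; last 1 first.
- by move=> kh; case: (@exit_mate_neq h) => //; rewrite ek kh.
- by apply: arc_ends; rewrite arc_sym; apply: mate_exit_connect.
exact: exit_kept ek.
Qed.

Lemma splice_mateE h : exit_of (mate (emb h)) = Some (emb (splice_mate h)).
Proof.
rewrite /splice_mate; have [k ek] := exit_mate_ex (emb_kept h).
by rewrite ek /=; have [k' -> ->] := projP (exit_kept ek).
Qed.

Lemma splice_mateK : involutive splice_mate.
Proof.
move=> h; apply: emb_inj; apply: Some_inj; rewrite -splice_mateE.
exact: exit_mateK (emb_kept h) (splice_mateE h).
Qed.

Lemma splice_mate_neq h : splice_mate h != h.
Proof.
by apply/eqP => eh; apply: exit_mate_neq (emb_kept h) _; rewrite splice_mateE eh.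
Qed.

Definition splice : fgraph :=
  FGraph (ncirc X + n_comp arc closed_arcs) splice_mateK splice_mate_neq.

Hypothesis J_opp : forall h, kept h -> J h = opp h.

Definition Junicursal : rel H := fun h k => (k == mate h) || (k == J h).

Lemma Junicursal_sym : connect_sym Junicursal.
Proof. exact/sym_connect_sym/inv2_sym/JK/mateK. Qed.

Lemma join_unkept h : ~~ kept h -> join h = J h.
Proof. by rewrite /join => /negbTE->. Qed.

Lemma arc_J h k : ~~ kept h -> Junicursal h k -> arc h k.
Proof. by rewrite /arc => /join_unkept->. Qed.

Lemma J_arc : subrel (connect arc) (connect Junicursal).
Proof.
apply: connect_sub => h k /orP[] /eqP->.
  by apply: connect1; rewrite /Junicursal eqxx.
rewrite /join; case: ifP => _ //.
by apply: connect1; rewrite /Junicursal eqxx orbT.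
Qed.

Lemma closed_arcs_unkept h : h \in closed_arcs -> ~~ kept h.
Proof. by move/forallP/(_ h); rewrite connect0. Qed.

Lemma closed_arcsS h k : h \in closed_arcs -> Junicursal h k -> k \in closed_arcs.
Proof.
move=> hc hk; apply/forallP=> l; apply/implyP=> kl.
move/forallP/(_ l)/implyP: (hc); apply.
by apply: connect_trans kl; apply/connect1/arc_J => //; apply: closed_arcs_unkept.
Qed.

Lemma closed_arcsE : closed Junicursal closed_arcs.
Proof.
by apply: (intro_closed Junicursal_sym) => h k hk hc; apply: closed_arcsS hk.
Qed.

Lemma n_comp_closed_arcs : n_comp Junicursal closed_arcs = n_comp arc closed_arcs.
Proof.
rewrite (adjunction_n_comp id Junicursal_sym arc_sym closed_arcsE) //.
split=> [h _|h k /= hc]; first by exists h.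
apply/idP/idP=> [/J_arc//|/connectP[s + ->]].
elim: s h hc => //= l s IHs h hc /andP[hl /(IHs l (closed_arcsS hc hl))].
by apply: connect_trans; apply/connect1/arc_J => //; apply: closed_arcs_unkept.
Qed.

Lemma arc_emb h k : connect arc (emb h) (emb k) -> k = h \/ k = splice_mate h.
Proof.
case: (emb h =P emb k) => [/emb_inj-> _|hk]; first by left.
move/arc_ends/perm_ends=> /(_ (emb_kept h) (emb_kept k) hk).
by rewrite splice_mateE => /Some_inj/emb_inj->; right.
Qed.

Lemma unicursal_sym Y : connect_sym (@unicursal Y).
Proof. exact/sym_connect_sym/inv2_sym/oppK/mateK. Qed.

Lemma connect_emb h k :
  connect (@unicursal splice) h k = connect Junicursal (emb h) (emb k).
Proof.
apply/idP/idP => [/connectP[s + ->]|].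
  elim: s h => //= l s IHs h /andP[hl /IHs]; apply: connect_trans.
  case/orP: hl => /eqP-> {l}.
    exact: J_arc (mate_exit_connect (splice_mateE h)).
  by apply: connect1; rewrite /Junicursal emb_opp J_opp ?emb_kept // eqxx orbT.
pose A := [pred z | [forall l, connect arc z (emb l)
                               ==> connect (@unicursal splice) h l]].
have Acl : closed Junicursal A.
  apply: (intro_closed Junicursal_sym) => z w zw zA.
  apply/forallP=> l; apply/implyP=> wl.
  have [zk|zk] := boolP (kept z); last first.
    move/forallP/(_ l)/implyP: zA; apply; apply: connect_trans wl.
    exact/connect1/arc_J.
  case/orP: zw => /eqP ew.
    move/forallP/(_ l)/implyP: zA; apply; apply: connect_trans wl.
    by apply: connect1; rewrite ew /arc eqxx.
  have [z' _ ez] := projP zk.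
  move/forallP/(_ z')/implyP: zA; rewrite ez connect0 => /(_ isT) hz'.
  have ho : connect (@unicursal splice) h (opp z').
    by apply: connect_trans hz' (connect1 _); rewrite /unicursal eqxx orbT.
  move: wl; rewrite ew J_opp // -ez -emb_opp => /arc_emb[->//|->].
  by apply: connect_trans ho (connect1 _); rewrite /unicursal eqxx.
move/(closed_connect Acl) => e.
have : emb k \in A.
  rewrite -e; apply/forallP=> l; apply/implyP=> /arc_emb[->//|->].
  by apply: connect1; rewrite /unicursal eqxx.
by move/forallP/(_ k); rewrite connect0.
Qed.

Lemma ncomp_splice : ncomp splice = ncirc X + n_comp Junicursal predT.
Proof.
rewrite /ncomp /= -addnA; congr (_ + _).
rewrite (n_compC closed_arcs) n_comp_closed_arcs; congr (_ + _).
have cC : closed Junicursal [predC closed_arcs].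
  by move=> h k hk; apply: (congr1 negb); apply: closed_arcsE.
rewrite (adjunction_n_comp emb Junicursal_sym (@unicursal_sym splice) cC) //.
  apply: eq_n_comp_r => h; rewrite !inE; symmetry.
  by apply/negP=> /closed_arcs_unkept; rewrite emb_kept.
split=> [h hc|h k _]; last exact: connect_emb.
apply: sigW; have /forallPn[k] := hc.
rewrite negb_imply negbK => /andP[hk kk].
by have [k' _ ek] := projP kk; exists k'; rewrite ek; apply: J_arc.
Qed.

End Splice.

Arguments splice {X} S {J} JK J_neq J_vtx.
Section Smoothing.
Variable X : fgraph.
Local Notation H := (half_edge X).

(* If h leaves its vertex, travel h is the half-edge through which the strand
   starting with h leaves the next vertex. *)
Definition travel (h : H) : H := opp (mate h).

Definition same_dir : rel H := fconnect travel.

(* At c, of the two half-edges adjacent to h, turn c h is the one with the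
   other direction: outgoing if h is incoming, incoming if h is outgoing.
   (This describes turn c when both strands at c belong to the same unicursal
   component, which is the only case in which smoothing will be used.) *)
Definition turn (c : 'I_(nvert X)) (h : H) : H :=
  let k : H := (h.1.1, ~~ h.1.2, h.2) in
  if vtx h == c then if same_dir h k then opp k else k else opp h.

Lemma travel_inj : injective travel.
Proof. exact: inj_comp (inv_inj (@oppK _)) (inv_inj (@mateK X)). Qed.

Lemma same_dir_sym : symmetric same_dir.
Proof. exact: fconnect_sym travel_inj. Qed.

Lemma same_dir_opp2 h k : same_dir (opp h) (opp k) = same_dir h k.
Proof.
suff imp l m : same_dir l m -> same_dir (opp l) (opp m).
  by apply/idP/idP => /imp //; rewrite !oppK.
case/connectP=> s + ->; elim: s l => [|n s IHs] l /=.
  by move=> _; apply: connect0.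
case/andP=> /eqP <- /IHs; apply: connect_trans.
rewrite -/(same_dir _ _) same_dir_sym; apply: connect1.
by rewrite /= /travel oppK mateK.
Qed.

Lemma same_dir_opp h : ~~ same_dir h (opp h).
Proof.
apply/negP=> /iter_findex; move: (findex _ _ _) => n.
pose x i := iter i travel h; rewrite -/(x n) => xn.
have xS i : x i.+1 = opp (mate (x i)) by [].
have sym i : i <= n -> opp (x (n - i)) = x i.
  elim: i => [|i IHi] lin; first by rewrite subn0 xn oppK.
  have := IHi (ltnW lin); rewrite -(subnSK lin) xS oppK => ej.
  by rewrite xS -ej mateK.
have := odd_double_half n; case: (odd n) => /= en.
  have lmn : n./2 < n by rewrite -[X in _ < X]en add1n ltnS -addnn leq_addr.
  have := sym _ lmn; rewrite xS.
  have -> : n - n./2.+1 = n./2.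
    by rewrite -[X in X - _]en add1n subSS -addnn addnK.
  by move/(inv_inj (@oppK _))/esym/eqP; rewrite (negbTE (mate_neq _)).
have lmn : n./2 <= n by rewrite -[X in _ <= X]en add0n -addnn leq_addr.
have := sym _ lmn; have -> : n - n./2 = n./2.
  by rewrite -[X in X - _]en add0n -addnn addnK.
by move/eqP; rewrite (negbTE (opp_neq _)).
Qed.

Lemma turn_vtx c h : vtx (turn c h) = vtx h.
Proof. by rewrite /turn; case: ifP => // _; case: ifP. Qed.

Lemma turn_neq c h : turn c h != h.
Proof.
rewrite /turn; case: ifP => _; last exact: opp_neq.
by case: h => [[v []] s]; case: ifP => _; apply/eqP; case.
Qed.

Lemma turn_opp c h : turn c (opp h) = opp (turn c h).
Proof.
rewrite /turn vtx_opp; case: ifP => // _.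
have -> : ((opp h).1.1, ~~ (opp h).1.2, (opp h).2)
          = opp (h.1.1, ~~ h.1.2, h.2) :> H by [].
by rewrite same_dir_opp2; case: ifP.
Qed.

Lemma turnK c : involutive (turn c).
Proof.
move=> h; rewrite {2}/turn; case: ifPn => hc; last first.
  by rewrite /turn vtx_opp (negbTE hc) oppK.
set k : H := (_, _, _).
have ek : turn c k = if same_dir h k then opp h else h.
  rewrite /turn (hc : vtx k == c) /= negbK same_dir_sym.
  by case: h @k {hc} => [[? ?] ?].
by case: ifP ek => [_|_ ->] //; rewrite turn_opp => ->; rewrite oppK.
Qed.

Lemma turn_out c h : vtx h != c -> turn c h = opp h.
Proof. by rewrite /turn => /negbTE->. Qed.

Definition smooth (c : 'I_(nvert X)) : fgraph :=
  splice [set c] (turnK c) (turn_neq c) (turn_vtx c).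

Hypothesis X1 : ncomp X = 1.

Lemma connected_one h k : connect (@unicursal X) h k.
Proof.
have := X1; rewrite /ncomp.
rewrite (n_compC (closure (@unicursal X) (pred2 h k))).
rewrite (n_comp_closure2 (@unicursal_sym X)).
by case: connect => //; rewrite addnCA.
Qed.

Lemma ncirc_one : 'I_(nvert X) -> ncirc X = 0.
Proof.
move=> c; have := X1; rewrite /ncomp.
pose h : H := (c, true, true).
rewrite (n_compC (closure (@unicursal X) (pred2 h h))).
rewrite (n_comp_closure2 (@unicursal_sym X)) connect0 addnCA add1n => -[/eqP].
by rewrite addn_eq0 => /andP[/eqP].
Qed.

Lemma same_dir_oppE h k : same_dir h (opp k) = ~~ same_dir h k.
Proof.
pose A := [pred z | same_dir h z || same_dir h (opp z)].
have Acl : closed (@unicursal X) A.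
  apply: (intro_closed (@unicursal_sym X)) => z w; rewrite !inE.
  case/orP=> /eqP->; last by rewrite oppK orbC.
  case/orP=> hz; apply/orP; [right|left].
    by apply: connect_trans hz (connect1 _); rewrite /= /travel.
  apply: connect_trans hz _; rewrite -/(same_dir _ _) same_dir_sym.
  by apply: connect1; rewrite /= /travel mateK.
have := closed_connect Acl (connected_one h k).
rewrite !inE [same_dir h h]connect0 /= => /esym hk.
apply/idP/idP => [ho|/negbTE hn]; last by rewrite hn in hk.
apply/negP=> hk'; case/negP: (same_dir_opp k).
by apply: connect_trans ho; rewrite -/(same_dir _ _) same_dir_sym.
Qed.

Lemma same_dir_travel h k : same_dir h (travel k) = same_dir h k.
Proof. by rewrite /same_dir -(same_fconnect1_r travel_inj). Qed.

Lemma same_dir_mate h k : same_dir h (mate k) = ~~ same_dir h k.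
Proof. by rewrite -[mate k]oppK same_dir_oppE same_dir_travel. Qed.

Section TwoComponents.
Variable c : 'I_(nvert X).
Let x : H := (c, true, true).
Let y : H := opp (turn c x).
Let out h := same_dir x h.
Let idx h := findex travel x h.

Lemma sm_turn_x : turn c x = opp y. Proof. by rewrite /y oppK. Qed.
Lemma sm_turn_y : turn c y = opp x. Proof. by rewrite /y turn_opp turnK. Qed.
Lemma sm_vtx_y : vtx y = c. Proof. by rewrite /y vtx_opp turn_vtx. Qed.

Lemma sm_neq_xy : y != x.
Proof.
by rewrite /y /turn eqxx; case: ifP => _; apply/eqP; case.
Qed.

Lemma sm_out_y : out y.
Proof.
rewrite /out /y /turn eqxx; case: ifP => [|/negbT]; first by rewrite oppK.
by rewrite same_dir_oppE.
Qed.

Lemma sm_out_x : out x. Proof. exact: connect0. Qed.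

Lemma sm_at_c h : vtx h = c -> [|| h == x, h == opp x, h == y | h == opp y].
Proof.
case: h => [[v p] s] hv; have {hv}-> : v = c := hv.
rewrite /y /turn eqxx.
by case: p s => [] []; case: ifP => _; rewrite /x /opp /= !xpair_eqE eqxx.
Qed.

Lemma sm_out_at_c h : vtx h = c -> out h -> h = x \/ h = y.
Proof.
move/sm_at_c=> /or4P[] /eqP->; auto.
  by rewrite /out same_dir_oppE [same_dir _ _]sm_out_x.
by rewrite /out same_dir_oppE [same_dir _ _]sm_out_y.
Qed.

Lemma sm_out_turn h : out (turn c h) = ~~ out h.
Proof.
have [hc|hc] := eqVneq (vtx h) c; last by rewrite turn_out // /out same_dir_oppE.
have ox : same_dir x x by exact: sm_out_x.
have oy : same_dir x y by exact: sm_out_y.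
have [[tx ty] hc'] := (sm_turn_x, sm_turn_y, sm_at_c hc); clearbody y.
by case/or4P: hc' => /eqP->; rewrite ?turn_opp ?tx ?ty /out !same_dir_oppE ?ox ?oy.
Qed.

Let side h := idx (if out h then h else mate h) < idx y.

Lemma sm_side_mate h : side (mate h) = side h.
Proof. by rewrite /side /out same_dir_mate; case: (same_dir x h); rewrite ?mateK. Qed.

Lemma sm_idx h : out h -> iter (idx h) travel x = h.
Proof. exact: iter_findex. Qed.

Lemma sm_pred h : out h ->
  (h = x /\ (idx (mate (opp h))).+1 = fingraph.order travel x)
  \/ idx h = (idx (mate (opp h))).+1.
Proof.
move=> oh; set h' := mate (opp h).
have eh : travel h' = h by rewrite /travel mateK oppK.
have oh' : out h' by rewrite /out -same_dir_travel eh.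
have lt : idx h' < fingraph.order travel x by apply: findex_max.
have ih : iter (idx h').+1 travel x = h by rewrite iterS sm_idx.
have [lt'|ge] := ltnP (idx h').+1 (fingraph.order travel x).
  by right; rewrite /idx -{1}ih findex_iter.
have e : (idx h').+1 = fingraph.order travel x by apply/eqP; rewrite eqn_leq lt.
by left; rewrite -{1}ih e (iter_order travel_inj).
Qed.

Lemma sm_side_out h : out h -> side (turn c h) = side h.
Proof.
move=> oh; rewrite {1}/side sm_out_turn oh /= /side oh.
have idx_x : idx x = 0 by exact: findex0.
have y_max : idx y < fingraph.order travel x by apply/findex_max/sm_out_y.
have y_gt0 : 0 < idx y.
  rewrite lt0n; apply/eqP => e; have := sm_idx sm_out_y; rewrite e /=.
  by move/eqP; rewrite eq_sym (negbTE sm_neq_xy).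
have [hc|hc] := eqVneq (vtx h) c.
  case: (sm_out_at_c hc oh) => ->.
    rewrite sm_turn_x idx_x y_gt0; case: (sm_pred sm_out_y) => [[/eqP]|->].
      by rewrite (negbTE sm_neq_xy).
    by rewrite ltnSn.
  rewrite sm_turn_y ltnn; case: (sm_pred sm_out_x) => [[_ e]|].
    by apply/negbTE; rewrite -leqNgt -ltnS e.
  by rewrite idx_x.
rewrite turn_out //; case: (sm_pred oh) => [[e _]|e].
  by rewrite e eqxx in hc.
rewrite e [RHS]ltn_neqAle -e; case: eqP => // ey; case/negP: hc.
by rewrite -(sm_idx oh) ey sm_idx ?sm_vtx_y // sm_out_y.
Qed.

Lemma sm_side_turn h : side (turn c h) = side h.
Proof.
have [oh|oh] := boolP (out h); first exact: sm_side_out.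
by rewrite -[in RHS](turnK c h) [RHS]sm_side_out ?sm_out_turn.
Qed.

Lemma ncomp_smooth : ncomp (smooth c) = 2.
Proof.
rewrite ncomp_splice; last by move=> h; rewrite /kept inE => /turn_out.
rewrite ncirc_one // add0n; set e := Junicursal _.
have e_sym : connect_sym e := Junicursal_sym (turnK c).
have eT : predT =i closure e (pred2 x y).
  move=> z; symmetry.
  have Acl : closed (@unicursal X) (closure e (pred2 x y)).
    apply: (intro_closed (@unicursal_sym X)) => u v uv ucl.
    have cl := closure_closed e_sym (pred2 x y).
    have pcl w : w \in pred2 x y -> w \in closure e (pred2 x y).
      exact: mem_closure.
    case/orP: uv => /eqP ev.
      by rewrite -(cl u) // ev /e /Junicursal eqxx.
    have [uc|uc] := eqVneq (vtx u) c; last first.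
      by rewrite -(cl u) // ev /e /Junicursal turn_out // eqxx orbT.
    have vc : vtx v = c by rewrite ev.
    case/or4P: (sm_at_c vc) => /eqP->.
    - by apply: pcl; rewrite !inE eqxx.
    - rewrite -(cl y); first by apply: pcl; rewrite !inE eqxx orbT.
      by rewrite /e /Junicursal sm_turn_y eqxx orbT.
    - by apply: pcl; rewrite !inE eqxx orbT.
    - rewrite -(cl x); first by apply: pcl; rewrite !inE eqxx.
      by rewrite /e /Junicursal sm_turn_x eqxx orbT.
  rewrite -(closed_connect Acl (connected_one x z)).
  by apply: mem_closure; rewrite !inE eqxx.
rewrite (eq_n_comp_r eT) (n_comp_closure2 e_sym).
suff /negbTE-> : ~~ connect e x y by [].
have Scl : closed e [pred h | side h].
  move=> u v /orP[] /eqP->; rewrite !inE.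
    by rewrite sm_side_mate.
  by rewrite sm_side_turn.
apply/negP=> /(closed_connect Scl); rewrite !inE /side.
rewrite [out x]sm_out_x [out y]sm_out_y ltnn [idx x]findex0.
rewrite lt0n => /negbT; rewrite negbK => /eqP e0.
by have := sm_idx sm_out_y; rewrite e0 /= => /eqP; rewrite eq_sym (negbTE sm_neq_xy).
Qed.

End TwoComponents.
End Smoothing.

(* Deleting the vertices of S with all strands running straight through them.
   For a kink or a bigon this is the deletion of the loop, resp. of the two
   edges e_i, followed by the prescribed joining: the strand leading to a joined
   half-edge runs through the loop, resp. through e_i, to the other one. *)
Definition delete (X : fgraph) (S : {set 'I_(nvert X)}) : fgraph :=
  splice S (@oppK _) (@opp_neq _) (@vtx_opp _).

(* Y is a copy of delete X S, and f sends the half-edges of Y to the surviving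
   half-edges of X. *)
Definition is_deletion (X : fgraph) (S : {set 'I_(nvert X)}) (Y : fgraph)
    (f : half_edge Y -> half_edge X) : Prop :=
  exists2 u : half_edge Y -> half_edge (delete S),
    is_fiso u & forall h, f h = emb (u h).

Definition kink (X : fgraph) (h : half_edge X) : bool := adjacent h (mate h).

Definition bigon (X : fgraph) (h1 h2 : half_edge X) : bool :=
  [&& vtx h1 != vtx (mate h1), adjacent h1 h2 & adjacent (mate h1) (mate h2)].

(* The triangle edges are {h_i, mate h_i}; h1, h2, h3 sit at A, B, C. *)
Definition triangle (X : fgraph) (h1 h2 h3 : half_edge X) : bool :=
  [&& uniq [:: vtx h1; vtx h2; vtx h3], adjacent (mate h1) h2,
      adjacent (mate h2) h3 & adjacent (mate h3) h1].

Lemma flip_mateK (T : finType) (s : {perm T}) (f : T -> T) :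
  involutive f -> involutive (fun h => s (f (s^-1%g h))).
Proof. by move=> fK h; rewrite permK fK permKV. Qed.

Lemma flip_mate_neq (T : finType) (s : {perm T}) (f : T -> T) :
  (forall h, f h != h) -> forall h, s (f (s^-1%g h)) != h.
Proof. by move=> fN h; rewrite -{2}(permKV s h) (inj_eq perm_inj). Qed.

(* A', B', C' are placed at A, B, C. On strand i, the two half-edges opposite to
   the triangle edge exchange their outer ends, which reverses the order of
   the two vertices on the strand; the triangle edges remain. *)
Definition flip (X : fgraph) (h1 h2 h3 : half_edge X) : fgraph :=
  let s : {perm half_edge X} :=
    (tperm (opp h1) (opp (mate h1)) * tperm (opp h2) (opp (mate h2))
     * tperm (opp h3) (opp (mate h3)))%g in
  FGraph (ncirc X) (flip_mateK s (@mateK X)) (flip_mate_neq s (@mate_neq X)).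

Definition fiso (X Y : fgraph) : Prop :=
  exists f : half_edge Y -> half_edge X, is_fiso f.

Definition fR1 (X Y : fgraph) : Prop :=
  exists (h : half_edge X) (f : half_edge Y -> half_edge X),
    kink h /\ is_deletion [set vtx h] f.

Definition fR2 (X Y : fgraph) : Prop :=
  exists (h1 h2 : half_edge X) (f : half_edge Y -> half_edge X),
    bigon h1 h2 /\ is_deletion [set vtx h1; vtx (mate h1)] f.

Definition fR3 (X Y : fgraph) : Prop :=
  exists (h1 h2 h3 : half_edge X)
         (f : half_edge Y -> half_edge (flip h1 h2 h3)),
    triangle h1 h2 h3 /\ is_fiso f.

Definition fequiv : fgraph -> fgraph -> Prop :=
  clos_refl_sym_trans fgraph
    (fun X Y => [\/ fiso X Y, fR1 X Y, fR2 X Y | fR3 X Y]).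

Definition fclass (X : fgraph) : set fgraph := [set Y | fequiv X Y]%classic.

(* The number of components being invariant, a free link has two components
   when one of its representatives does. *)
Definition flink2 : Type :=
  {L : set fgraph | `[< exists2 X : fgraph, ncomp X = 2 & L = fclass X >]}.

HB.instance Definition _ := Choice.on flink2.

Definition smooth_link (X : fgraph) (X1 : ncomp X = 1) (c : 'I_(nvert X)) :
  flink2 :=
  exist _ (fclass (smooth c))
    (asboolT (ex_intro2 _ _ (smooth c) (ncomp_smooth X1 c) erefl)).

Definition flink2_space : lmodType 'F_2 := {malg 'F_2[flink2]}.

Section GGraphs.
Variable G : groupType.

(* out h says that h emanates from its vertex. Up to isomorphism an oriented
   circular component carries no information. *)
Record ggraph : Type := GGraph {
  gbase :> fgraph;
  out : half_edge gbase -> bool;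
  label : 'I_(nvert gbase) -> G;
  out_mate : forall h, out (mate h) = ~~ out h;
  out_opp : forall h, out (opp h) = out h;
  out_adjacent : forall h k, adjacent h k -> out k = ~~ out h
}.

Definition preserves (X Y : ggraph) (f : half_edge Y -> half_edge X) : Prop :=
  (forall h, out (f h) = out h) /\
  (forall h, label (vtx (f h)) = label (vtx h)).

Definition giso (X Y : ggraph) : Prop :=
  exists f : half_edge Y -> half_edge X, is_fiso f /\ preserves f.

Definition gR1 (X Y : ggraph) : Prop :=
  exists (h : half_edge X) (f : half_edge Y -> half_edge X),
    [/\ kink h, label (vtx h) = 1%g, is_deletion [set vtx h] f & preserves f].

Definition gR2 (X Y : ggraph) : Prop :=
  exists (h1 h2 : half_edge X) (f : half_edge Y -> half_edge X),
    [/\ bigon h1 h2, label (vtx (mate h1)) = (label (vtx h1))^-1%g,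
        is_deletion [set vtx h1; vtx (mate h1)] f & preserves f].

(* Since flip exchanges the outer ends on each strand and keeps the orientation
   of the outer edges, the four half-edges at each of the three vertices
   change their direction. *)
Definition gR3 (X Y : ggraph) : Prop :=
  exists (h1 h2 h3 : half_edge X)
         (f : half_edge Y -> half_edge (flip h1 h2 h3)),
    let T := [set vtx h1; vtx h2; vtx h3] in
    [/\ triangle h1 h2 h3 /\ [&& out h1, out h2 & out h3],
        (label (vtx h1) * label (vtx h2) * label (vtx h3))%g = 1%g,
        is_fiso f,
        forall h : half_edge Y, let k : half_edge X := f h in
          out h = if vtx k \in T then ~~ out k else out k
      & forall h : half_edge Y, let k : half_edge X := f h in
          label (vtx h) =
            if vtx k \in T then (label (vtx k))^-1%g else label (vtx k)].

Definition gequiv : ggraph -> ggraph -> Prop :=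
  clos_refl_sym_trans ggraph
    (fun X Y => [\/ giso X Y, gR1 X Y, gR2 X Y | gR3 X Y]).

Definition Delta (g : G) (X : ggraph) (X1 : ncomp X = 1) : flink2_space :=
  (\sum_(c | (label c == g) || (label c == g^-1%g)) << smooth_link X1 c >>)%R.

Definition Delta_all (X : ggraph) (X1 : ncomp X = 1) : flink2_space :=
  (\sum_(c | label c != 1%g) << smooth_link X1 c >>)%R.

(* The letter (i, b) stands for the generator i if b = false and for its
   inverse if b = true. *)
Definition word (n : nat) : Type := seq ('I_n * bool).

Definition eval_word n (x : 'I_n -> G) (w : word n) : G :=
  (\prod_(l <- w) (if l.2 then (x l.1)^-1 else x l.1))%g.

Inductive insertion n (rels : seq (word n)) : word n -> word n -> Prop :=
| InsCancel (u v : word n) i b :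
    insertion rels (u ++ v) (u ++ (i, b) :: (i, ~~ b) :: v)
| InsRelator (u r v : word n) :
    r \in rels -> insertion rels (u ++ v) (u ++ r ++ v).

Definition finitely_presented : Prop :=
  exists (n : nat) (x : 'I_n -> G) (rels : seq (word n)),
    (forall g : G, exists w, eval_word x w = g) /\
    (forall w, eval_word x w = 1%g <->
               clos_refl_sym_trans (word n) (insertion rels) w [::]).
End GGraphs.

Arguments finitely_presented G : clear implicits.

(* Main.v *)
From Pilot Require Import Defs.
From Stdlib Require Import Relation_Operators.
From mathcomp Require Import all_boot all_algebra fingroup perm.
From mathcomp Require Import boolp monalg.
From mathcomp Require Import all_boot.
Import Pilot.Defs.

(** A move performed at vertices other than c can be performed just as well
after the smoothing at c, because deleting some vertices and joining their
half-edges in pairs commutes with doing the same at other vertices, and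
because no move changes which way the knot runs through c relative to the
rest.  So the vertices away from the move keep their labels and the free links
of their smoothings; only the vertices taking part in the move have to be
looked at.

In R1 that vertex has label 1 and is not summed over.  In R2 the two vertices
v and w have mutually inverse labels, so both are summed over or none is, and
their smoothings give the same free link: if the two strands traverse the
bigon in the same direction, the two smoothings are isomorphic
(smooth_bigon_parallel); if they traverse it in opposite directions, smoothing
one vertex turns the other into a kink, and after removing it by R1 the two
results agree (smooth_bigon_antiparallel).  The two terms cancel modulo 2.
In R3 the label of each vertex of the triangle is inverted, and the smoothing
at A before the move is equivalent to the smoothing at A' after it: either the
smoothing joins the two triangle edges at A, so that B and C span a bigon
on both sides and its removal by R2 gives the same graph (smooth_flip_bigon), or
the smoothed graphs are isomorphic through an exchange of B and C
(smooth_flip_swap).  The cases of B and C follow by rotating the triangle.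

The outer ends of a fragment may be joined to each other in any way, closing up
edges into circles, so isomorphisms are never built edge by edge.  Instead
every graph obtained from X by splicing is described by a relation on the
half-edges of X whose classes are its edges and circles (presents); such
descriptions compose (presents_splice), and two graphs are isomorphic once
their relations have corresponding classes (presents_iso).  Checking the
latter only involves the few half-edges of the fragment. *)

Set Implicit Arguments.
Unset Strict Implicit.
Unset Printing Implicit Defensive.

Local Open Scope nat_scope.

(** * Classes of relations and presentations of graphs *)

(** Maps in both directions, inverse to each other up to connectedness, put the
classes of two relations on different carriers in bijection. *)
Definition rel_equiv (T1 T2 : finType) (e1 : rel T1) (e2 : rel T2)
    (r : T1 -> T2) (s : T2 -> T1) : Prop :=
  [/\ forall t u, e1 t u -> connect e2 (r t) (r u),
      forall t u, e2 t u -> connect e1 (s t) (s u),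
      forall t, connect e1 t (s (r t))
    & forall t, connect e2 t (r (s t))].

Lemma connect_homo (T1 T2 : finType) (e1 : rel T1) (e2 : rel T2) (r : T1 -> T2) :
  (forall t u, e1 t u -> connect e2 (r t) (r u)) ->
  forall t u, connect e1 t u -> connect e2 (r t) (r u).
Proof.
move=> er t u /connectP[p + ->]; elim: p t => //= v p IHp t /andP[/er tv /IHp].
exact: connect_trans.
Qed.

Lemma rel_equiv_sym (T1 T2 : finType) (e1 : rel T1) (e2 : rel T2) r s :
  rel_equiv e1 e2 r s -> rel_equiv e2 e1 s r.
Proof. by case. Qed.

Lemma rel_equiv_connect (T1 T2 : finType) (e1 : rel T1) (e2 : rel T2) r s :
  connect_sym e1 -> rel_equiv e1 e2 r s ->
  forall t u, connect e2 (r t) (r u) = connect e1 t u.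
Proof.
move=> sym1 [er es sr rs] t u; apply/idP/idP; last exact: connect_homo.
move/(connect_homo es)/(connect_trans (sr t))=> tu.
by apply: connect_trans tu _; rewrite sym1.
Qed.

Lemma n_comp_equiv (T1 T2 : finType) (e1 : rel T1) (e2 : rel T2) r s
    (a1 : {pred T1}) (a2 : {pred T2}) :
  connect_sym e1 -> connect_sym e2 -> rel_equiv e1 e2 r s -> closed e1 a1 ->
  (forall t, (t \in a2) = (s t \in a1)) -> n_comp e1 a1 = n_comp e2 a2.
Proof.
move=> sym1 sym2 eqv cl1 a12; have [er es sr rs] := eqv.
rewrite (adjunction_n_comp s sym1 sym2 cl1); first exact: eq_n_comp_r.
split=> [t _|t u _]; first by exists (r t).
by rewrite (rel_equiv_connect sym2 (rel_equiv_sym eqv)).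
Qed.

Lemma n_comp_split (T : finType) (e : rel T) (a b : {pred T}) :
  n_comp e a = n_comp e [predI a & b] + n_comp e [predD a & b].
Proof.
rewrite /n_comp_mem -[LHS](cardID b); congr (_ + _); apply: eq_card => t.
  by rewrite !inE andbA.
by rewrite !inE andbCA.
Qed.

(** Such classes close up to circles of Y. *)
Definition unmet (T : finType) (e : rel T) (Y : fgraph)
    (phi : half_edge Y -> T) : {pred T} :=
  [pred t | [forall k, ~~ connect e t (phi k)]].

(** Y is obtained from the classes of e by cutting at the points phi h: a class
is an edge if it contains such points, of which there are then two, and a
circle otherwise; n counts further circles.  The carrier T may be that of a
graph from which Y was obtained by several splices, which are thus compared
without ever leaving T. *)
Definition presents (T : finType) (e : rel T) (n : nat) (Y : fgraph)
    (phi : half_edge Y -> T) : Prop :=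
  [/\ connect_sym e,
      forall h k, connect e (phi h) (phi k) = (k == h) || (k == mate h)
    & ncirc Y = n + n_comp e (unmet e phi)].

(** Splicing Y at S adds to a presentation the connections h -- J h at S. *)
Definition joined (T : finType) (e : rel T) (Y : fgraph) (phi : half_edge Y -> T)
    (S : {set 'I_(nvert Y)}) (J : half_edge Y -> half_edge Y) : rel T :=
  fun t u => e t u || [exists h, [&& vtx h \in S, t == phi h & u == phi (J h)]].

Section Presentations.
Variables (T : finType) (e : rel T) (n : nat) (Y : fgraph).
Variable phi : half_edge Y -> T.

Lemma unmet_closed : connect_sym e -> closed e (unmet e phi).
Proof.
move=> sym; apply: (intro_closed sym) => t u tu.
move/forallP=> Ht; apply/forallP=> k; apply: contra (Ht k).
by apply: connect_trans; apply: connect1.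
Qed.

Lemma joined_rel S J t u : e t u -> joined e phi S J t u.
Proof. by rewrite /joined => ->. Qed.

Lemma joined_J (S : {set 'I_(nvert Y)}) J h :
  vtx h \in S -> joined e phi S J (phi h) (phi (J h)).
Proof. by move=> hS; apply/orP; right; apply/existsP; exists h; rewrite hS !eqxx. Qed.

Lemma joinedP (S : {set 'I_(nvert Y)}) J t u : joined e phi S J t u ->
  e t u \/ exists h, [/\ vtx h \in S, t = phi h & u = phi (J h)].
Proof.
by case/orP=> [|/existsP[h /and3P[hS /eqP-> /eqP->]]]; [left|right; exists h].
Qed.

Lemma connect_joined S J t u : connect e t u -> connect (joined e phi S J) t u.
Proof. by apply: connect_sub => a b ab; apply/connect1/joined_rel. Qed.

Lemma joined_sym S J : involutive J -> (forall h, vtx (J h) = vtx h) ->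
  connect_sym e -> connect_sym (joined e phi S J).
Proof.
move=> JK J_vtx sym.
have imp t u : connect (joined e phi S J) t u -> connect (joined e phi S J) u t.
  move/connectP=> [p + ->]; elim: p t => [|v p IHp] t /=; first by rewrite connect0.
  case/andP=> tv /IHp pv; apply: connect_trans pv _.
  case: (joinedP tv) => [etv|[h [hS -> ->]]].
    by apply: connect_joined; rewrite sym; apply: connect1.
  by apply: connect1; rewrite -{2}(JK h); apply: joined_J; rewrite J_vtx.
by move=> t u; apply/idP/idP; apply: imp.
Qed.

End Presentations.

Definition edge (X : fgraph) : rel (half_edge X) := fun h k => k == mate h.

Lemma presents_self (X : fgraph) :
  presents (@edge X) (ncirc X) id.
Proof.
set e := @edge X.
have eE h k : connect e h k = (k == h) || (k == mate h).
  apply/idP/idP=> [|/orP[]/eqP->]; last 2 first.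
  - exact: connect0.
  - exact/connect1/eqxx.
  case/connectP=> p + ->; elim/last_ind: p => [|p a IHp]; first by rewrite eqxx.
  rewrite rcons_path last_rcons /e /edge => /andP[/IHp/orP[]/eqP-> /eqP->].
    by rewrite eqxx orbT.
  by rewrite mateK eqxx.
have sym : connect_sym e.
  by move=> h k; rewrite !eE [h == k]eq_sym [h == mate k]eq_sym (inv_eq (@mateK X)).
split=> //; rewrite (eq_n_comp_r (a' := pred0)) ?addn0.
  by rewrite [n_comp _ _]eq_card0 ?addn0 // => t; rewrite !inE andbF.
by move=> t; apply/forallP=> /(_ t); rewrite connect0.
Qed.

Section PresentsSplice.
Variables (T : finType) (e : rel T) (n : nat) (Y : fgraph).
Variable phi : half_edge Y -> T.
Variables (S : {set 'I_(nvert Y)}) (J : half_edge Y -> half_edge Y).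
Hypotheses (JK : involutive J) (J_neq : forall h, J h != h).
Hypothesis J_vtx : forall h, vtx (J h) = vtx h.
Hypothesis pY : presents e n phi.

Let e' := joined e phi S J.
Let arcs := Defs.arc S J.

(** Between points phi h, the enlarged relation sees exactly the arcs of the
splice: the e-classes contribute the edges, the new connections the joins. *)
Lemma joined_arc h k : connect e' (phi h) (phi k) = connect arcs h k.
Proof.
have [sym ephi _] := pY.
have arcs_sym : connect_sym arcs := arc_sym S JK J_vtx.
have arc1 a : connect arcs a (mate a) by apply: connect1; rewrite /arcs /Defs.arc eqxx.
have arcJ a : vtx a \in S -> connect arcs a (J a).
  move=> aS; apply: connect1; rewrite /arcs /Defs.arc /join /kept aS /=.
  by rewrite eqxx orbT.
have e'1 a : connect e' (phi a) (phi (mate a)).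
  by apply: connect_joined; rewrite ephi eqxx orbT.
apply/idP/idP=> [|hk]; last first.
  apply: connect_homo hk => a b /orP[]/eqP-> //.
  rewrite /join /kept; case: ifP => [_|/negbFE aS]; first exact: connect0.
  exact/connect1/joined_J.
pose B := [pred t | [forall l, connect e t (phi l) ==> connect arcs h l]].
have Bcl : closed e' B.
  apply: (intro_closed (joined_sym _ _ JK J_vtx sym)) => t u tu /forallP tB.
  apply/forallP=> l; apply/implyP=> ul.
  case: (joinedP tu) => [etu|[a [aS et eu]]].
    by apply: (implyP (tB l)); apply: connect_trans ul; apply: connect1.
  have ha : connect arcs h a by apply: (implyP (tB a)); rewrite et connect0.
  have hJ : connect arcs h (J a) := connect_trans ha (arcJ a aS).
  move: ul; rewrite eu ephi => /orP[]/eqP-> //.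
  exact: connect_trans hJ (arc1 _).
have hB : phi h \in B.
  by apply/forallP=> l; apply/implyP; rewrite ephi => /orP[]/eqP->.
move/(closed_connect Bcl); rewrite hB => /esym/forallP/(_ k)/implyP; apply.
exact: connect0.
Qed.

(** The classes that miss the surviving half-edges are of two kinds, which
account for the two summands of the number of circles of a splice: those
that missed Y already, and those met by Y, which are the closed arcs. *)
Lemma presents_splice :
  presents e' n (fun h : half_edge (splice S JK J_neq J_vtx) => phi (emb h)).
Proof.
have [sym ephi encirc] := pY.
have arcs_sym : connect_sym arcs := arc_sym S JK J_vtx.
have sym' : connect_sym e' := joined_sym _ _ JK J_vtx sym.
split=> //= [h k|].
  rewrite joined_arc; apply/idP/idP.
    by case/(arc_emb JK J_vtx)=> ->; rewrite eqxx ?orbT.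
  case/orP=> /eqP->; first exact: connect0.
  exact: mate_exit_connect (splice_mateE JK J_vtx h).
rewrite encirc -addnA; congr (_ + _).
set phi' := (fun h => phi (emb h)).
rewrite [RHS](n_comp_split e' _ (unmet e phi)); congr (_ + _).
  have cl : closed e' (unmet e phi).
    apply: (intro_closed sym') => t u tu tU.
    case: (joinedP tu) => [etu|[h [_ et _]]].
      by rewrite -(unmet_closed _ _ etu).
    by move/forallP/(_ h): tU; rewrite et connect0.
  have sub t u : t \in unmet e phi -> connect e' t u -> connect e t u.
    move=> tU /connectP[p + ->]; elim/last_ind: p => [|p v IHp].
      by move=> _; apply: connect0.
    rewrite rcons_path last_rcons => /andP[tp pv].
    apply: (connect_trans (IHp tp)).
    case: (joinedP pv) => [ev|[h [_ et _]]]; first exact: connect1.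
    by move/forallP/(_ h): tU; rewrite -et IHp.
  rewrite [RHS](adjunction_n_comp id sym' sym); first last.
  - split=> [t _|t u /andP[_ tU]]; first by exists t; apply: connect0.
    by apply/idP/idP; [apply: connect_joined|apply: sub].
  - move=> t u tu; rewrite !inE; congr (_ && _); last exact: cl tu.
    exact: unmet_closed tu.
  apply: eq_n_comp_r => t; rewrite !inE andbC.
  case tU: (t \in unmet e phi) => /=; last by move: tU; rewrite inE => ->.
  move: (tU); rewrite inE => -> /=; symmetry; apply/forallP=> k; apply/negP.
  by move=> /(sub _ _ tU); move/forallP/(_ (emb k))/negP: tU.
rewrite (adjunction_n_comp phi sym' arcs_sym).
- apply: eq_n_comp_r => h; rewrite !inE; symmetry.
  have -> /= : ~~ [forall k, ~~ connect e (phi h) (phi k)].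
    by apply/forallPn; exists h; rewrite connect0.
  apply/forallP/forallP=> [hU k|hC k].
    apply/implyP=> hk; apply/negP=> kk; have [k' _ ek] := projP kk.
    by have := hU k'; rewrite /phi' /= ek joined_arc hk.
  rewrite /phi' /= joined_arc; apply/negP=> hk.
  by have := hC (emb k); rewrite hk emb_kept.
- move=> t u tu; rewrite !inE; congr (~~ _ && _); last exact: unmet_closed tu.
  case: (joinedP tu) => [etu|[h [_ -> ->]]]; first exact: unmet_closed etu.
  by apply/forallP/forallP=> [/(_ h)|/(_ (J h))]; rewrite connect0.
split=> [t|h k _]; last by rewrite joined_arc.
rewrite !inE => /andP[/forallPn tP _]; apply: sigW.
by case: tP => k; rewrite negbK => tk; exists k; apply: connect_joined.
Qed.

End PresentsSplice.

(** * Isomorphisms from presentations; directions *)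

(** f identifies the vertices of one graph with the vertices outside S of
another, respecting the framing; edges are ignored. *)
Definition placed m n (S : {set 'I_n}) (f : hedge m -> hedge n) : Prop :=
  [/\ injective f, forall h, f (opp h) = opp (f h),
      forall h k, (vtx (f h) == vtx (f k)) = (vtx h == vtx k),
      forall h, vtx (f h) \notin S
    & forall k, vtx k \notin S -> exists h, f h = k].

Lemma placed_comp l m n (S : {set 'I_m}) (S' S'' : {set 'I_n})
    (g : hedge l -> hedge m) (f : hedge m -> hedge n) :
  placed S' f -> placed S g ->
  (forall h, (vtx (f h) \in S'') = (vtx h \in S)) ->
  placed (S' :|: S'') (fun h => f (g h)).
Proof.
move=> [finj fo fv fS fim] [ginj go gv gS gim] SS; split=> [|h|h k|h|k].
- exact: inj_comp.
- by rewrite go fo.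
- by rewrite fv gv.
- by rewrite in_setU negb_or fS SS gS.
rewrite in_setU negb_or => /andP[/fim[h <-]]; rewrite SS => /gim[h' <-].
by exists h'.
Qed.

Lemma placed_emb (X : fgraph) (S : {set 'I_(nvert X)}) : placed S (@emb X S).
Proof.
split=> [||h k||k kS]; [exact: emb_inj|by []| |exact: emb_kept|].
  by rewrite /vtx /emb /= (inj_eq val_inj) (inj_eq enum_val_inj).
by have [h _ <-] := projP (kS : kept S k); exists h.
Qed.

Lemma placed_fiso (X Y : fgraph) (f : half_edge Y -> half_edge X) :
  is_fiso f -> placed set0 f.
Proof.
case=> fbij _ fo fv _; split=> // [|h|k _]; first exact: bij_inj.
  by rewrite inE.
by have [g _ fK] := fbij; exists (g k).
Qed.

Lemma placed_adjacent m n (S : {set 'I_n}) (f : hedge m -> hedge n) :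
  placed S f -> forall h k, adjacent (f h) (f k) = adjacent h k.
Proof.
by case=> finj fo fv _ _ h k; rewrite /adjacent fv -fo !(inj_eq finj).
Qed.

Section PresentsIso.
Variables (T1 T2 : finType) (e1 : rel T1) (e2 : rel T2) (n : nat).
Variables (Y1 Y2 : fgraph) (phi1 : half_edge Y1 -> T1) (phi2 : half_edge Y2 -> T2).
Variables (m : nat) (S : {set 'I_m}).
Variables (psi1 : half_edge Y1 -> hedge m) (psi2 : half_edge Y2 -> hedge m).

(** An edge is recovered from its class, so a framed bijection of half-edges
that respects classes is an isomorphism; the circles are then the remaining
classes on both sides, hence equal in number. *)
Lemma presents_iso r s :
  presents e1 n phi1 -> presents e2 n phi2 -> placed S psi1 -> placed S psi2 ->
  rel_equiv e1 e2 r s ->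
  (forall h k, psi1 h = psi2 k -> connect e2 (r (phi1 h)) (phi2 k)) ->
  exists2 g : half_edge Y1 -> half_edge Y2, is_fiso g & forall h, psi2 (g h) = psi1 h.
Proof.
move=> [sym1 ephi1 enc1] [sym2 ephi2 enc2] [inj1 o1 v1 S1 im1] [inj2 o2 v2 S2 im2].
move=> eqv phi12.
have gP h : {k | psi2 k = psi1 h} by apply: cid; apply: im2.
have gP' h : {k | psi1 k = psi2 h} by apply: cid; apply: im1.
pose g h := sval (gP h); pose g' h := sval (gP' h).
have gE h : psi2 (g h) = psi1 h := svalP (gP h).
have g'E h : psi1 (g' h) = psi2 h := svalP (gP' h).
have gK : cancel g g' by move=> h; apply: inj1; rewrite g'E gE.
have g'K : cancel g' g by move=> h; apply: inj2; rewrite gE g'E.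
have phig h : connect e2 (r (phi1 h)) (phi2 (g h)) by apply: phi12; rewrite gE.
have er := rel_equiv_connect sym1 eqv.
have [_ _ _ rs] := eqv.
exists g => //; split.
- by exists g'.
- move=> h; have : connect e2 (phi2 (g h)) (phi2 (g (mate h))).
    rewrite sym2 -(same_connect sym2 (phig _)) sym2 -(same_connect sym2 (phig _)).
    by rewrite er ephi1 eqxx orbT.
  by rewrite ephi2 (can_eq gK) (negbTE (mate_neq h)) => /eqP.
- by move=> h; apply: inj2; rewrite gE o1 o2 gE.
- by move=> h k; rewrite -v2 !gE v1.
rewrite enc1 enc2; congr (_ + _).
apply: (n_comp_equiv sym1 sym2 eqv (unmet_closed phi1 sym1)) => t.
rewrite !inE; apply/forallP/forallP=> tU k.
  apply: contra (tU (g k)); rewrite -er => tk.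
  exact: connect_trans (rs t) (connect_trans tk (phig k)).
rewrite -(g'K k); apply: contra (tU (g' k)) => tk.
rewrite -er (same_connect sym2 (y := t)); last by rewrite sym2.
by rewrite sym2 (same_connect sym2 (phig _)) sym2.
Qed.

End PresentsIso.

Lemma rel_equiv_id (T : finType) (e1 e2 : rel T) : e1 =2 e2 -> rel_equiv e1 e2 id id.
Proof. by move=> e12; split=> // t u tu; apply/connect1; rewrite ?e12 // -e12. Qed.

Lemma presents_eq_iso (T : finType) (e1 e2 : rel T) n (Y1 Y2 : fgraph) phi1 phi2
    m (S : {set 'I_m}) psi1 psi2 :
  @presents T e1 n Y1 phi1 -> @presents T e2 n Y2 phi2 ->
  placed S psi1 -> placed S psi2 -> e1 =2 e2 ->
  (forall h k, psi1 h = psi2 k -> phi1 h = phi2 k) ->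
  exists2 g : half_edge Y1 -> half_edge Y2, is_fiso g & forall h, psi2 (g h) = psi1 h.
Proof.
move=> p1 p2 pl1 pl2 /rel_equiv_id e12 phi12.
apply: presents_iso p1 p2 pl1 pl2 e12 _ => h k /phi12 /= ->; exact: connect0.
Qed.

Lemma presents_fiso (T : finType) (e : rel T) n (X Y : fgraph) phi
    (f : half_edge Y -> half_edge X) :
  presents e n phi -> is_fiso f -> presents e n (fun h => phi (f h)).
Proof.
move=> [sym ephi enc] [fbij fm _ _ ef]; split=> // [h k|].
  by rewrite ephi -fm !(inj_eq (bij_inj fbij)).
rewrite ef enc; congr (_ + _); apply: eq_n_comp_r => t; rewrite !inE.
apply/forallP/forallP=> tU k //; have [g _ fK] := fbij.
by rewrite -(fK k).
Qed.

(** Joins made at the vertices of Y can be made at the corresponding vertices of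
X.  This is what makes splices at disjoint sets of vertices commute. *)
Lemma joined_pull (T : finType) (e : rel T) (X Y : fgraph)
    (phi : half_edge X -> T) (f : half_edge Y -> half_edge X)
    (S SX : {set 'I_(nvert X)}) (SY : {set 'I_(nvert Y)}) JX JY :
  placed S f -> (forall h, vtx h \in SX -> vtx h \notin S) ->
  (forall h, (vtx (f h) \in SX) = (vtx h \in SY)) ->
  (forall h, vtx h \in SY -> f (JY h) = JX (f h)) ->
  joined e (fun h => phi (f h)) SY JY =2 joined e phi SX JX.
Proof.
move=> [_ _ _ _ fim] SXS SXY JXY t u; congr (_ || _).
apply/existsP/existsP=> -[h /and3P[hS /eqP-> /eqP->]].
  by exists (f h); rewrite SXY hS JXY // !eqxx.
have [k ek] := fim _ (SXS h hS); exists k.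
by rewrite -SXY ek hS JXY -?SXY ek // !eqxx.
Qed.

Lemma joinedC (T : finType) (e : rel T) (X : fgraph) (phi : half_edge X -> T)
    S1 J1 S2 J2 :
  joined (joined e phi S1 J1) phi S2 J2 =2 joined (joined e phi S2 J2) phi S1 J1.
Proof. by move=> t u; rewrite /joined orbAC. Qed.

(** The flip of a triangle has this form; keeping the permutation as a parameter
allows rewriting with it. *)
Definition reroute (X : fgraph) (s : {perm half_edge X}) : fgraph :=
  FGraph (ncirc X) (flip_mateK s (@mateK X)) (flip_mate_neq s (@mate_neq X)).

(** Conjugating the edges by s amounts to placing each half-edge h at the point
where its inverse image under s used to be. *)
Lemma presents_reroute (T : finType) (e : rel T) n (X : fgraph)
    (phi : half_edge X -> T) (s : {perm half_edge X}) :
  presents e n phi ->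
  presents e n (fun h : half_edge (reroute s) => phi (s^-1%g h)).
Proof.
move=> [sym ephi enc]; split=> // [h k|].
  by rewrite ephi (inj_eq perm_inj) /= -(inj_eq (@perm_inj _ s) _ (mate _)) permKV.
rewrite /= enc; congr (_ + _); apply: eq_n_comp_r => t; rewrite !inE.
apply/forallP/forallP=> tU k; first exact: tU.
by rewrite -(permK s k); apply: tU.
Qed.

Lemma adjacentE n (h k l : hedge n) : adjacent h k -> vtx l = vtx h ->
  [|| l == h, l == opp h, l == k | l == opp k].
Proof.
case: h k l => [[v p] s] [[w q] t] [[u b] a].
rewrite /adjacent /vtx /opp /= => /and3P[/eqP<- n1 n2 ->].
move: n1 n2; rewrite !xpair_eqE !eqxx /=.
by case: p q b s t a => [] [] [] [] [] [].
Qed.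

Section OneComponent.
Variable X : fgraph.
Hypothesis X1 : ncomp X = 1.
Implicit Types h k : half_edge X.

(** A one-component graph has just two coherent directions, so any coherent
two-colouring of its half-edges computes same_dir. *)
Lemma same_dir_unique (o : half_edge X -> bool) :
  (forall h, o (mate h) = ~~ o h) -> (forall h, o (opp h) = ~~ o h) ->
  forall h k, same_dir h k = (o h == o k).
Proof.
move=> om oo h k.
have imp a b : same_dir a b -> o a = o b.
  case/connectP=> p + ->; elim: p a => //= c p IHp a /andP[/eqP <- /IHp <-].
  by rewrite /travel oo om negbK.
have [/imp->|] := boolP (same_dir h k); first by rewrite eqxx.
rewrite -same_dir_oppE // => /imp->; rewrite oo; by case: (o k).
Qed.

Lemma same_dir_refl h : same_dir h h. Proof. exact: connect0. Qed.

Lemma same_dir_turn h : same_dir h (turn (vtx h) h) = false.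
Proof.
rewrite /turn eqxx; case: ifP => //.
by rewrite same_dir_oppE // => ->.
Qed.

Lemma adjacent_turn h : adjacent h (turn (vtx h) h).
Proof.
rewrite /adjacent turn_vtx eqxx eq_sym turn_neq /= /turn eqxx.
by case: h => [[v []] s]; case: ifP => _; apply/eqP; case.
Qed.

(** This characterizes turn without reference to the coordinates of half-edges,
which isomorphisms need not preserve. *)
Lemma turn_eq h k : adjacent h k -> same_dir h k = false -> turn (vtx h) h = k.
Proof.
move=> hk hnk; have tv := turn_vtx (vtx h) h; have /and3P[_ n1 n2] := adjacent_turn h.
case/or4P: (adjacentE hk tv) => /eqP // e.
- by rewrite eq_sym e eqxx in n1.
- by rewrite e eqxx in n2.
by have := same_dir_turn h; rewrite e same_dir_oppE // hnk.
Qed.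

Lemma turnE h k : adjacent h k ->
  turn (vtx h) h = if same_dir h k then opp k else k.
Proof.
move=> hk; case: ifP => hd; last exact: turn_eq.
apply: turn_eq; last by rewrite same_dir_oppE // hd.
case/and3P: hk => ev n1 n2; rewrite /adjacent vtx_opp ev.
by rewrite (inj_eq (inv_inj (@oppK _))) [k == h]eq_sym n1 andbT eq_sym (inv_eq (@oppK _)).
Qed.

End OneComponent.

Lemma turn_placed (X Y : fgraph) (S : {set 'I_(nvert X)})
    (f : half_edge Y -> half_edge X) :
  ncomp X = 1 -> ncomp Y = 1 -> placed S f ->
  (forall h k, vtx h = vtx k -> same_dir (f h) (f k) = same_dir h k) ->
  forall h, f (turn (vtx h) h) = turn (vtx (f h)) (f h).
Proof.
move=> X1 Y1 pf fd h; symmetry; apply: turn_eq => //.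
  by rewrite (placed_adjacent pf) adjacent_turn.
by rewrite fd ?turn_vtx // same_dir_turn.
Qed.

(** * Smoothing, deletion and isomorphism *)

Lemma ncomp_fiso (X Y : fgraph) (f : half_edge Y -> half_edge X) :
  is_fiso f -> ncomp Y = ncomp X.
Proof.
case=> -[g fK gK] fm fo _ ef; rewrite /ncomp ef; congr (_ + _).
apply: (n_comp_equiv (r := f) (s := g)) => //; try exact: unicursal_sym.
split=> [h k|h k|h|h]; rewrite ?fK ?gK ?connect0 // => /orP[]/eqP->.
- by rewrite fm; apply: connect1; rewrite /unicursal eqxx.
- by rewrite fo; apply: connect1; rewrite /unicursal eqxx orbT.
- by rewrite -{2}(gK h) -fm fK; apply: connect1; rewrite /unicursal eqxx.
by rewrite -{2}(gK h) -fo fK; apply: connect1; rewrite /unicursal eqxx orbT.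
Qed.

Lemma ncomp_delete (X : fgraph) (S : {set 'I_(nvert X)}) :
  ncomp (delete S) = ncomp X.
Proof. by rewrite /delete ncomp_splice. Qed.

Lemma same_dir_fiso (X Y : fgraph) (f : half_edge Y -> half_edge X) :
  ncomp X = 1 -> is_fiso f -> forall h k, same_dir (f h) (f k) = same_dir h k.
Proof.
move=> X1 fi h k; have Y1 : ncomp Y = 1 by rewrite (ncomp_fiso fi).
have [_ fm fo _ _] := fi.
rewrite (same_dir_unique Y1 (o := fun l => same_dir (f h) (f l))).
- by rewrite same_dir_refl; case: same_dir.
- by move=> l; rewrite fm same_dir_mate.
by move=> l; rewrite fo same_dir_oppE.
Qed.

(** A strand of the deletion runs straight through deleted vertices, where opp
and mate each reverse the direction. *)
Lemma same_dir_delete (X : fgraph) (S : {set 'I_(nvert X)}) :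
  ncomp X = 1 -> forall h k : half_edge (delete S),
  same_dir (emb h) (emb k) = same_dir h k.
Proof.
move=> X1 h k; have Z1 : ncomp (delete S) = 1 by rewrite ncomp_delete.
rewrite (same_dir_unique Z1 (o := fun l => same_dir (emb h) (emb l))).
- by rewrite same_dir_refl; case: same_dir.
- move=> l; have /exit_first[n <- nk] := splice_mateE (@oppK _) (@vtx_opp _) l.
  rewrite -same_dir_mate //; elim: n nk => //= n IHn nk.
  rewrite -IHn; last by move=> i /ltnW; apply: nk.
  rewrite /step /join (negbTE (nk n _)) // same_dir_mate //.
  by rewrite same_dir_oppE // negbK.
by move=> l; rewrite emb_opp same_dir_oppE.
Qed.

Lemma emb_mate (X : fgraph) (S : {set 'I_(nvert X)}) J JK J_neq J_vtx
    (h : half_edge (@splice X S J JK J_neq J_vtx)) :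
  vtx (mate (emb h)) \notin S -> emb (mate h) = mate (emb h).
Proof.
move=> hS; have := splice_mateE JK J_vtx h.
by rewrite (exit_of_kept _ (hS : kept S _)) => -[].
Qed.

Lemma presents_smooth (T : finType) (e : rel T) n (X : fgraph)
    (phi : half_edge X -> T) (c : 'I_(nvert X)) :
  presents e n phi ->
  presents (joined e phi [set c] (turn c)) n
    (fun h : half_edge (smooth c) => phi (emb h)).
Proof. exact: presents_splice. Qed.

Lemma presents_delete (T : finType) (e : rel T) n (X : fgraph)
    (phi : half_edge X -> T) (S : {set 'I_(nvert X)}) :
  presents e n phi ->
  presents (joined e phi S (@opp _)) n
    (fun h : half_edge (delete S) => phi (emb h)).
Proof. exact: presents_splice. Qed.

(** The vertex set S' of the smoothed graph is named by the vertex set S of X, so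
that both kinds of joins are visible on the same carrier. *)
Lemma presents_smooth_delete (T : finType) (e : rel T) n (X : fgraph)
    (phi : half_edge X -> T) (c : 'I_(nvert X)) (S : {set 'I_(nvert X)})
    (S' : {set 'I_(nvert (smooth c))}) :
  presents e n phi -> c \notin S ->
  (forall h : half_edge (smooth c), (vtx (emb h) \in S) = (vtx h \in S')) ->
  presents (joined (joined e phi [set c] (turn c)) phi S (@opp _)) n
    (fun h : half_edge (delete S') => phi (emb (emb h))).
Proof.
move=> pX cS SS'; have := presents_delete S' (presents_smooth c pX).
set e1 := joined _ _ _ _; set e2 := joined _ _ _ _.
suff -> : e1 = e2 by [].
apply/funext=> t; apply/funext=> u; apply: joined_pull => //.
  exact: placed_emb.
by move=> h hS; rewrite inE; apply: contraNneq cS => <-.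
Qed.

(** Both sides are presented on the half-edges of X by the same two families of
joins, added in different order; the turns at c agree because deletion
preserves directions. *)
Lemma smooth_delete_iso (X : fgraph) (S : {set 'I_(nvert X)}) (c : 'I_(nvert X))
    (S' : {set 'I_(nvert (smooth c))}) (c' : 'I_(nvert (delete S))) :
  ncomp X = 1 -> c \notin S ->
  (forall h : half_edge (smooth c), (vtx (emb h) \in S) = (vtx h \in S')) ->
  (forall h : half_edge (delete S), (vtx (emb h) == c) = (vtx h == c')) ->
  fiso (delete S') (smooth c').
Proof.
move=> X1 cS SS' cc'; have Z1 : ncomp (delete S) = 1 by rewrite ncomp_delete.
have p1 := presents_smooth_delete (presents_self X) cS SS'.
have p2 := presents_smooth c' (presents_delete S (presents_self X)).
have pl1 : placed ([set c] :|: S) (fun h : half_edge (delete S') => emb (emb h)).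
  by apply: (placed_comp (@placed_emb X [set c]) (@placed_emb _ S') SS').
have pl2 : placed ([set c] :|: S) (fun h : half_edge (smooth c') => emb (emb h)).
  rewrite setUC.
  apply: (placed_comp (@placed_emb X S) (@placed_emb (delete S) [set c'])) => h.
  by rewrite !inE cc'.
have [|//|g gi _] := presents_eq_iso p2 p1 pl2 pl1; last by exists g.
move=> t u; rewrite joinedC.
apply: (@joined_pull _ _ X (delete S) id _ _ _ _ _ _ (@placed_emb X S)).
- by move=> h; rewrite inE => /eqP->.
- by move=> h; rewrite !inE cc'.
move=> h; rewrite inE => /eqP hc'; rewrite -{1}hc'.
have /eqP <- : vtx (emb h) == c by rewrite cc' hc'.
apply: turn_placed => //; first exact: placed_emb.
by move=> a b _; apply: same_dir_delete.
Qed.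

Lemma smooth_fiso (X Y : fgraph) (f : half_edge Y -> half_edge X) c c' :
  ncomp X = 1 -> is_fiso f -> (forall h, (vtx (f h) == c) = (vtx h == c')) ->
  fiso (smooth c) (smooth c').
Proof.
move=> X1 fi cc'; have Y1 : ncomp Y = 1 by rewrite (ncomp_fiso fi).
have pf := placed_fiso fi.
have p1 := presents_smooth c (presents_self X).
have p2 := presents_smooth c' (presents_fiso (presents_self X) fi).
have pl1 : placed [set c] (@emb X [set c]) := placed_emb _.
have pl2 : placed [set c] (fun h : half_edge (smooth c') => f (emb h)).
  rewrite -(set0U [set c]).
  apply: (placed_comp pf (@placed_emb Y [set c'])) => h.
  by rewrite !inE cc'.
have [|//|g gi _] := presents_eq_iso p2 p1 pl2 pl1; last by exists g.
move=> t u; apply: (joined_pull _ id pf) => h; rewrite ?inE ?cc' //.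
move=> /eqP hc'; rewrite -{1}hc'.
have /eqP <- : vtx (f h) == c by rewrite cc' hc'.
apply: (turn_placed X1 Y1 pf) => a b _; exact: same_dir_fiso.
Qed.

(** * Kinks and bigons away from the smoothed vertex; collapsing *)

Lemma fequiv_sym X Y : fequiv X Y -> fequiv Y X. Proof. exact: rst_sym. Qed.
Lemma fequiv_trans X Y Z : fequiv X Y -> fequiv Y Z -> fequiv X Z.
Proof. exact: rst_trans. Qed.
Lemma fequiv_iso X Y : fiso X Y -> fequiv X Y.
Proof. by move=> i; apply: rst_step; constructor 1. Qed.

Lemma is_deletion_emb (X : fgraph) (S : {set 'I_(nvert X)}) :
  @is_deletion X S (delete S) (@emb X S).
Proof. by exists id => //; split=> //; exists id. Qed.

Lemma fequiv_R1 (X : fgraph) (h : half_edge X) :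
  kink h -> fequiv X (delete [set vtx h]).
Proof.
by move=> kh; apply: rst_step; constructor 2; exists h, (@emb X _); split=> //;
   apply: is_deletion_emb.
Qed.

Lemma fequiv_R2 (X : fgraph) (h1 h2 : half_edge X) :
  bigon h1 h2 -> fequiv X (delete [set vtx h1; vtx (mate h1)]).
Proof.
by move=> bh; apply: rst_step; constructor 3; exists h1, h2, (@emb X _); split=> //;
   apply: is_deletion_emb.
Qed.

Lemma fequiv_R3 (X : fgraph) (h1 h2 h3 : half_edge X) :
  triangle h1 h2 h3 -> fequiv X (flip h1 h2 h3).
Proof.
move=> th; apply: rst_step; constructor 4; exists h1, h2, h3, id.
by split=> //; split=> //; exists id.
Qed.

Lemma adjacent_sym n (h k : hedge n) : adjacent h k = adjacent k h.
Proof.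
by rewrite /adjacent eq_sym [h == k]eq_sym [k == opp h]eq_sym (inv_eq (@oppK _)).
Qed.

Lemma vtx_emb (X : fgraph) (S : {set 'I_(nvert X)}) (h k : hedge #|{: survivor S}|) :
  (vtx (emb h) == vtx (emb k)) = (vtx h == vtx k).
Proof. by case: (placed_emb S). Qed.

Lemma emb_onto (X : fgraph) (S : {set 'I_(nvert X)}) (h : half_edge X) :
  vtx h \notin S -> exists k : hedge #|{: survivor S}|, emb k = h.
Proof. by case: (placed_emb S) => _ _ _ _; apply. Qed.

(** The kink survives the smoothing at c, and deleting it commutes with the
smoothing. *)
Lemma smooth_kink (X : fgraph) (h : half_edge X) (c : 'I_(nvert X))
    (c' : 'I_(nvert (delete [set vtx h]))) :
  ncomp X = 1 -> kink h -> c \notin [set vtx h] ->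
  (forall k : half_edge (delete [set vtx h]), (vtx (emb k) == c) = (vtx k == c')) ->
  fequiv (smooth c) (smooth c').
Proof.
move=> X1 kh ch cc'; have hc : vtx h \notin [set c] by move: ch; rewrite !inE eq_sym.
have [k ek] : exists k : half_edge (smooth c), emb k = h := emb_onto hc.
have ev : vtx (mate h) = vtx h by case/and3P: kh => /eqP.
have kk : kink k.
  rewrite /kink -(placed_adjacent (@placed_emb X [set c])) emb_mate ek ?ev //.
apply: fequiv_trans (fequiv_R1 kk) _; apply: fequiv_iso.
apply: smooth_delete_iso cc' => // l.
by rewrite !inE -ek vtx_emb.
Qed.

Lemma smooth_bigon (X : fgraph) (h1 h2 : half_edge X) (c : 'I_(nvert X))
    (c' : 'I_(nvert (delete [set vtx h1; vtx (mate h1)]))) :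
  ncomp X = 1 -> bigon h1 h2 -> c \notin [set vtx h1; vtx (mate h1)] ->
  (forall k : half_edge (delete [set vtx h1; vtx (mate h1)]),
    (vtx (emb k) == c) = (vtx k == c')) ->
  fequiv (smooth c) (smooth c').
Proof.
move=> X1 /and3P[nv ad ad'] ch cc'.
have : c \notin [set vtx h1; vtx (mate h1)] by [].
rewrite !inE negb_or => /andP[ch1 cm1].
have h1c : vtx h1 \notin [set c] by rewrite inE eq_sym.
have m1c : vtx (mate h1) \notin [set c] by rewrite inE eq_sym.
have [/eqP v2 /eqP w2] : vtx h1 == vtx h2 /\ vtx (mate h1) == vtx (mate h2).
  by case/andP: ad; case/andP: ad'.
have [k1 ek1] : exists k : half_edge (smooth c), emb k = h1 by apply: emb_onto.
have [k2 ek2] : exists k : half_edge (smooth c), emb k = h2.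
  by apply: emb_onto; rewrite -v2.
have em1 : emb (mate k1) = mate h1 by rewrite emb_mate ek1.
have em2 : emb (mate k2) = mate h2 by rewrite emb_mate ek2 // -w2.
have bk : bigon k1 k2.
  rewrite /bigon -!(placed_adjacent (@placed_emb X [set c])) -vtx_emb.
  by rewrite ek1 ek2 em1 em2 nv ad ad'.
apply: fequiv_trans (fequiv_R2 bk) _; apply: fequiv_iso.
apply: smooth_delete_iso cc' => // l.
by rewrite !inE -em1 -ek1 !vtx_emb.
Qed.

(** The edge of each listed p.1 is pushed to p.2.  Rewiring a fragment attaches
the edges inside it to other points of its boundary; collapsing these edges
onto the boundary, in a way suited to each wiring, is how two wirings are
compared. *)
Definition collapse (X : fgraph) (ps : seq (half_edge X * half_edge X))
    (t : half_edge X) : half_edge X :=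
  foldr (fun p u => if (t == p.1) || (t == mate p.1) then p.2 else u) t ps.

Section Collapse.
Variable X : fgraph.
Implicit Types (t u : half_edge X) (hs : seq (half_edge X)).
Implicit Types ps : seq (half_edge X * half_edge X).

Definition inner hs t := (t \in hs) || (mate t \in hs).

Lemma inner_mate hs t : inner hs (mate t) = inner hs t.
Proof. by rewrite /inner mateK orbC. Qed.

Lemma collapse_outer ps t : ~~ inner (map fst ps) t -> collapse ps t = t.
Proof.
elim: ps => //= p ps IHps; rewrite /inner !inE /= -!orbA !negb_or.
rewrite (inv_eq (@mateK X)).
by case/and4P=> /negbTE-> tp /negbTE-> tq; rewrite IHps // /inner negb_or tp tq.
Qed.

Lemma collapse_inner ps t : inner (map fst ps) t ->
  exists2 p, p \in ps & collapse ps t = p.2 /\ (t == p.1) || (t == mate p.1).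
Proof.
elim: ps => //= p ps IHps; rewrite /inner !inE /= (inv_eq (@mateK X)) orbACA.
case: ifP => [tp _|_ /IHps[q qps eq]]; first by exists p; rewrite ?mem_head.
by exists q; rewrite ?inE ?qps ?orbT.
Qed.

Lemma collapse_mate ps t :
  inner (map fst ps) t -> collapse ps (mate t) = collapse ps t.
Proof.
elim: ps => //= p ps IHps; rewrite /inner !inE /= (inv_eq (@mateK X)) orbACA.
rewrite (inj_eq (inv_inj (@mateK X))) [(t == mate _) || (t == _)]orbC.
by case: ifP => //= _ /IHps.
Qed.

(** Two wirings are equivalent as soon as each extra connection of the one,
once the inner edges are collapsed, holds in the other. *)
Lemma collapse_equiv (e1 e2 : rel (half_edge X)) ps1 ps2 hs :
  subrel (@edge X) e1 -> subrel (@edge X) e2 ->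
  connect_sym e1 -> connect_sym e2 ->
  map fst ps1 = hs -> map fst ps2 = hs ->
  {in ps1, forall p, connect e1 p.1 p.2 && ~~ inner hs p.2} ->
  {in ps2, forall p, connect e2 p.1 p.2 && ~~ inner hs p.2} ->
  (forall t u, e1 t u -> edge t u \/ connect e2 (collapse ps1 t) (collapse ps1 u)) ->
  (forall t u, e2 t u -> edge t u \/ connect e1 (collapse ps2 t) (collapse ps2 u)) ->
  rel_equiv e1 e2 (collapse ps1) (collapse ps2).
Proof.
move=> edge1 edge2 sym1 sym2 ps1hs ps2hs ps1P ps2P e12 e21.
have homo ps e e' : subrel (@edge X) e' -> map fst ps = hs ->
    (forall t u, e t u -> edge t u \/ connect e' (collapse ps t) (collapse ps u)) ->
    forall t u, e t u -> connect e' (collapse ps t) (collapse ps u).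
  move=> ee' pshs ep t u /ep[/eqP->|//]; have [ti|to] := boolP (inner hs t).
    by rewrite collapse_mate ?pshs ?connect0.
  rewrite !collapse_outer ?pshs ?inner_mate //.
  by apply/connect1/ee'/eqxx.
have out ps e : map fst ps = hs ->
    {in ps, forall p, connect e p.1 p.2 && ~~ inner hs p.2} ->
    forall t, ~~ inner hs (collapse ps t).
  move=> pshs psP t; have [ti|to] := boolP (inner hs t).
    rewrite -pshs in ti; have [p pps [-> _]] := collapse_inner ti.
    by case/andP: (psP p pps).
  by rewrite collapse_outer ?pshs.
have near ps e : subrel (@edge X) e -> connect_sym e -> map fst ps = hs ->
    {in ps, forall p, connect e p.1 p.2 && ~~ inner hs p.2} ->
    forall t, connect e t (collapse ps t).
  move=> ee sym pshs psP t; have [ti|to] := boolP (inner hs t); last first.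
    by rewrite collapse_outer ?pshs ?connect0.
  rewrite -pshs in ti; have [p pps [-> tp]] := collapse_inner ti.
  have /andP[pp _] := psP p pps; case/orP: tp => /eqP-> //.
  by apply: connect_trans pp; rewrite sym; apply/connect1/ee/eqxx.
split.
- exact: homo.
- exact: homo.
- by move=> t; rewrite (@collapse_outer ps2) ?ps2hs ?(out ps1 e1) //; apply: near.
by move=> t; rewrite (@collapse_outer ps1) ?ps1hs ?(out ps2 e2) //; apply: near.
Qed.

End Collapse.

(** * Smoothing at the ends of a bigon *)

(** The fragments involve at most twelve half-edges, known to be distinct; the
values of collapse and of exchanges on them are decided by these facts. *)
Ltac decide_eqs := repeat first
  [ rewrite eqxx
  | match goal with
    | H : is_true (?x != ?y) |- context [?x == ?y] => rewrite (negbTE H)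
    | H : is_true (?x != ?y) |- context [?y == ?x] => rewrite [y == x]eq_sym (negbTE H)
    end ].
Ltac split_conj H :=
  lazymatch type of H with
  | is_true (_ && _) =>
    let A := fresh "N" in let B := fresh "N" in
    case/andP: H => A B; split_conj A; split_conj B
  | _ => idtac
  end.
Ltac split_uniq U := rewrite uniq_pairwise /= ?andbT in U; split_conj U.
Ltac solve_outer := by rewrite /inner !inE !(inv_eq (@mateK _)); decide_eqs.

Definition corner n (h k : hedge n) := [:: h; opp h; k; opp k].

Lemma mem_corner n (h k l : hedge n) :
  adjacent h k -> (l \in corner h k) = (vtx l == vtx h).
Proof.
move=> hk; rewrite !inE; apply/idP/idP=> [|/eqP lh]; last exact: adjacentE hk lh.
by case/and3P: hk => /eqP e _ _ /or4P[] /eqP->; rewrite ?vtx_opp ?e.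
Qed.

Lemma corner_uniq n (h k : hedge n) : adjacent h k -> uniq (corner h k).
Proof.
case/and3P=> _ n1 n2; have n3 : h != opp k by rewrite eq_sym (inv_eq (@oppK _)).
rewrite /= !inE !negb_or (inj_eq (inv_inj (@oppK _))) n1 n3 [h == opp h]eq_sym.
by rewrite [k == opp k]eq_sym !opp_neq [opp h == k]eq_sym n2.
Qed.

Lemma corners_uniq n (h k : hedge n) (s : seq (hedge n)) :
  adjacent h k -> uniq s -> all (fun l => vtx l != vtx h) s ->
  uniq (corner h k ++ s).
Proof.
move=> hk us /allP sv; rewrite cat_uniq corner_uniq // us andbT /=.
by apply/hasPn=> l /sv; rewrite mem_corner.
Qed.

(** The isomorphisms between smoothed graphs move crossings; on half-edges they
are exchanges of two framed corners. *)
Lemma corner_swap n (a b a' b' : hedge n) :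
  adjacent a b -> adjacent a' b' -> vtx a != vtx a' ->
  exists F : hedge n -> hedge n,
  [/\ placed set0 F, forall l, vtx (F l) = tperm (vtx a) (vtx a') (vtx l),
      [/\ F a = a', F b = b', F a' = a & F b' = b]
    & forall l, vtx l != vtx a -> vtx l != vtx a' -> F l = l].
Proof.
move=> ab ab' nv.
have [/eqP eb /eqP eb'] : vtx a == vtx b /\ vtx a' == vtx b'.
  by case/andP: ab; case/andP: ab'.
pose F l := if l == a then a' else if l == opp a then opp a' else
  if l == b then b' else if l == opp b then opp b' else
  if l == a' then a else if l == opp a' then opp a else
  if l == b' then b else if l == opp b' then opp b else l.
have U : uniq (corner a b ++ corner a' b').
  apply: corners_uniq => //; first exact: corner_uniq.
  by rewrite /= !vtx_opp -eb' [_ == vtx a]eq_sym nv.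
split_uniq U.
have Fa : F a = a' by rewrite /F; decide_eqs.
have Fb : F b = b' by rewrite /F; decide_eqs.
have Fa' : F a' = a by rewrite /F; decide_eqs.
have Fb' : F b' = b by rewrite /F; decide_eqs.
have Foa : F (opp a) = opp a' by rewrite /F; decide_eqs.
have Fob : F (opp b) = opp b' by rewrite /F; decide_eqs.
have Foa' : F (opp a') = opp a by rewrite /F; decide_eqs.
have Fob' : F (opp b') = opp b by rewrite /F; decide_eqs.
have Fout l : vtx l != vtx a -> vtx l != vtx a' -> F l = l.
  move=> la la'; have ne k : vtx l != vtx k -> (l == k) = false.
    by move=> lk; apply: contraNF lk => /eqP->.
  by rewrite /F !ne ?vtx_opp -?eb -?eb'.
have FE (P : hedge n -> Prop) :
    [/\ P a, P (opp a), P b & P (opp b)] ->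
    [/\ P a', P (opp a'), P b' & P (opp b')] ->
    (forall l, vtx l != vtx a -> vtx l != vtx a' -> P l) -> forall l, P l.
  move=> [P1 P2 P3 P4] [P5 P6 P7 P8] P9 l.
  have [la|la] := eqVneq (vtx l) (vtx a).
    by case/or4P: (adjacentE ab la) => /eqP->.
  have [la'|la'] := eqVneq (vtx l) (vtx a').
    by case/or4P: (adjacentE ab' la') => /eqP->.
  exact: P9.
have vF l : vtx (F l) = tperm (vtx a) (vtx a') (vtx l).
  elim/FE: l => [||l la la']; last by rewrite Fout // tpermD // eq_sym.
    by rewrite Fa Foa Fb Fob !vtx_opp -eb -eb' tpermL.
  by rewrite Fa' Foa' Fb' Fob' !vtx_opp -eb -eb' tpermR.
have FK : involutive F.
  elim/FE=> [||l la la']; last by rewrite !Fout.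
    by rewrite Fa Foa Fb Fob.
  by rewrite Fa' Foa' Fb' Fob'.
exists F; split=> //; split=> [|l|h k|h|k _].
- exact: inv_inj.
- elim/FE: l => [||l la la']; last by rewrite !Fout.
    by rewrite !oppK Fa Foa Fb Fob !oppK.
  by rewrite !oppK Fa' Foa' Fb' Fob' !oppK.
- by rewrite !vF (inj_eq perm_inj).
- by rewrite inE.
by exists (F k).
Qed.

Lemma bigon_uniq (X : fgraph) (h1 h2 : half_edge X) :
  bigon h1 h2 -> uniq (corner h1 h2 ++ corner (mate h1) (mate h2)).
Proof.
case/and3P=> nv ad ad'; apply: corners_uniq => //; first exact: corner_uniq.
by case/and3P: ad' => /eqP e _ _; rewrite /= !vtx_opp -e [_ == vtx h1]eq_sym nv.
Qed.

Lemma adjacent_opp n (h k : hedge n) : adjacent (opp h) (opp k) = adjacent h k.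
Proof. by rewrite /adjacent !vtx_opp !(inj_eq (inv_inj (@oppK n))). Qed.

Lemma bigon_mate (X : fgraph) (h1 h2 : half_edge X) :
  bigon h1 h2 -> bigon (mate h1) (mate h2).
Proof. by rewrite /bigon !mateK eq_sym andbA andbAC -andbA. Qed.

Lemma bigon_same_dir (X : fgraph) (h1 h2 : half_edge X) : ncomp X = 1 ->
  same_dir (mate h1) (mate h2) = same_dir h1 h2.
Proof.
by move=> X1; rewrite same_dir_mate // same_dir_sym same_dir_mate // negbK same_dir_sym.
Qed.

Lemma bigon_turn (X : fgraph) (h1 h2 : half_edge X) :
  ncomp X = 1 -> bigon h1 h2 ->
  turn (vtx h1) h1 = (if same_dir h1 h2 then opp h2 else h2) /\
  turn (vtx h1) h2 = (if same_dir h1 h2 then opp h1 else h1).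
Proof.
move=> X1 /and3P[_ ad _]; split; first exact: turnE.
have ad2 : adjacent h2 h1 by rewrite adjacent_sym.
have /and3P[/eqP<- _ _] := ad2.
by rewrite (turnE X1 ad2) same_dir_sym.
Qed.

Lemma edge_mate (X : fgraph) (e : rel (half_edge X)) h :
  subrel (@edge X) e -> connect e h (mate h).
Proof. by move=> ee; apply/connect1/ee/eqxx. Qed.

Lemma joined_connect (X : fgraph) (e : rel (half_edge X)) (S : {set 'I_(nvert X)}) J h k :
  vtx h \in S -> J h = k -> connect (joined e id S J) h k.
Proof. by move=> hS <-; apply/connect1/(joined_J e id). Qed.

(** Let strand i run along the edge of h_i, and let v, w be the ends of the
bigon.  In both smoothings one crossing remains, and the outer end of strand 1
at v is opposite there to that of strand 2 at w, and vice versa. *)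
Lemma smooth_bigon_parallel (X : fgraph) (h1 h2 : half_edge X) :
  ncomp X = 1 -> bigon h1 h2 -> same_dir h1 h2 ->
  fiso (smooth (vtx (mate h1))) (smooth (vtx h1)).
Proof.
move=> X1 bh sd; have /and3P[nv ad ad'] := bh.
have [/eqP ev /eqP ew] : vtx h1 == vtx h2 /\ vtx (mate h1) == vtx (mate h2).
  by case/andP: ad; case/andP: ad'.
have U := bigon_uniq bh; split_uniq U.
have [t1 t2] := bigon_turn X1 bh.
have [t1' t2'] := bigon_turn X1 (bigon_mate bh).
rewrite bigon_same_dir // sd in t1' t2'; rewrite sd in t1 t2.
set v := vtx h1 in t1 t2 *; set w := vtx (mate h1) in t1' t2' *.
have [pv pw] := (presents_smooth v (presents_self X), presents_smooth w (presents_self X)).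
set e1 := joined _ _ _ _ in pv; set e2 := joined _ _ _ _ in pw.
have [[sym1 _ _] [sym2 _ _]] := (pv, pw).
have edge1 : subrel (@edge X) e1 by apply: joined_rel.
have edge2 : subrel (@edge X) e2 by apply: joined_rel.
have j1 h k : vtx h = v -> turn v h = k -> connect e1 h k.
  by move=> hv; apply: joined_connect; rewrite inE hv.
have j2 h k : vtx h = w -> turn w h = k -> connect e2 h k.
  by move=> hw; apply: joined_connect; rewrite inE hw.
(* After smoothing at v, the edge of h1 leads to the end of strand 2 at v, and
   the edge of h2 to the end of strand 1; likewise at w. *)
pose ps1 := [:: (h1, opp h2); (h2, opp h1)].
pose ps2 := [:: (h1, opp (mate h2)); (h2, opp (mate h1))].
have eqv : rel_equiv e1 e2 (collapse ps1) (collapse ps2).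
  apply: (@collapse_equiv _ _ _ _ _ [:: h1; h2]) => //.
  - move=> p; rewrite !inE => /orP[]/eqP-> /=; rewrite j1 //;
      solve_outer.
  - move=> p; rewrite !inE => /orP[]/eqP-> /=; apply/andP; split;
      try solve_outer.
      by apply: connect_trans (edge_mate _ edge2) _; apply: j2.
    by apply: connect_trans (edge_mate _ edge2) _; apply: j2.
  - move=> t u /joinedP[|[h [hv -> ->]]]; [by left|right; move: hv].
    rewrite inE => /eqP/(adjacentE ad)/or4P[]/eqP->;
      by rewrite /= ?turn_opp ?t1 ?t2 ?oppK /collapse /=; decide_eqs; rewrite connect0.
  - move=> t u /joinedP[|[h [hv -> ->]]]; [by left|right; move: hv].
    rewrite inE => /eqP/(adjacentE ad')/or4P[]/eqP->;
      by rewrite /= ?turn_opp ?t1' ?t2' ?oppK /collapse /=; decide_eqs; rewrite connect0.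
have ads : adjacent (opp h1) (opp h2) by rewrite adjacent_opp.
have ads' : adjacent (mate h2) (mate h1) by rewrite adjacent_sym.
have nv' : vtx (mate h2) != vtx (opp h1) by rewrite -ew eq_sym.
have [F [pF vF [Fa Fb _ _] Fout]] := corner_swap ads' ads nv'.
have Fo l : F (opp l) = opp (F l) by case: pF.
have plv : placed [set w] (fun h : half_edge (smooth v) => F (emb h)).
  rewrite -[[set w]]set0U; apply: (placed_comp pF (@placed_emb X [set v])) => h.
  by rewrite !inE vF -ew -/w -(inj_eq (@perm_inj _ (tperm w v))) tpermK tpermL.
have plw : placed [set w] (fun h : half_edge (smooth w) => emb h) := @placed_emb X [set w].
have [|g gi _] := presents_iso pv pw plv plw eqv; last by exists g.
move=> h k <-; have hv := emb_kept h; move: (emb h) hv => l; rewrite /kept inE /= => lv.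
have [/(adjacentE ad')/or4P[]/eqP->|lw] := eqVneq (vtx l) w.
- by rewrite Fb /collapse /=; decide_eqs; rewrite connect0.
- rewrite Fo Fb oppK /collapse /=; decide_eqs.
  by rewrite sym2; apply: connect_trans (edge_mate _ edge2) _; apply: j2.
- by rewrite Fa /collapse /=; decide_eqs; rewrite connect0.
- rewrite Fo Fa oppK /collapse /=; decide_eqs.
  by rewrite sym2; apply: connect_trans (edge_mate _ edge2) _; apply: j2.
have ne m : vtx l != vtx m -> (l == m) = false.
  by move=> lm; apply: contraNF lm => /eqP->.
by rewrite Fout -?ew // /collapse /= !ne -?ev -?ew // connect0.
Qed.

(** The smoothing joins h1 and h2, which closes the bigon to a loop at its other
vertex. *)
Lemma smooth_bigon_kink (X : fgraph) (h1 h2 : half_edge X) :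
  ncomp X = 1 -> bigon h1 h2 -> ~~ same_dir h1 h2 ->
  exists S' : {set 'I_(nvert (smooth (vtx h1)))},
    (forall h : half_edge (smooth (vtx h1)),
       (vtx (emb h) \in [set vtx (mate h1)]) = (vtx h \in S')) /\
    fequiv (smooth (vtx h1)) (delete S').
Proof.
move=> X1 bh /negbTE sd; have /and3P[nv ad ad'] := bh.
have [t1 _] := bigon_turn X1 bh; rewrite sd in t1.
set v := vtx h1 in t1 *.
have /eqP ew : vtx (mate h1) == vtx (mate h2) by case/andP: ad'.
have [k1 ek1] : exists k : half_edge (smooth v), emb k = mate h1.
  by apply: emb_onto; rewrite inE eq_sym.
have [k2 ek2] : exists k : half_edge (smooth v), emb k = mate h2.
  by apply: emb_onto; rewrite inE -ew eq_sym.
have [_ eE _] := presents_smooth v (presents_self X).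
have := eE k1 k2; set e := joined _ _ _ _; rewrite ek1 ek2.
have edge1 : subrel (@edge X) e by apply: joined_rel.
have -> : connect e (mate h1) (mate h2).
  apply: connect_trans (edge_mate _ edge1) _; rewrite mateK.
  apply: connect_trans (edge_mate _ edge1).
  by apply: joined_connect t1; rewrite inE.
have n12 : k2 == k1 = false.
  rewrite -(inj_eq (@emb_inj _ _)) ek1 ek2 eq_sym.
  by case/and3P: ad' => _ /negbTE.
rewrite n12 => /esym/eqP em.
have kk : kink k1.
  by rewrite /kink -em -(placed_adjacent (@placed_emb X [set v])) ek1 ek2.
exists [set vtx k1]; split; last exact: fequiv_R1.
by move=> h; rewrite !inE -ek1 vtx_emb.
Qed.

(** On both sides the two ends at each vertex of the bigon are joined to each
other; only the inner edges hang on different ends. *)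
Lemma smooth_bigon_antiparallel (X : fgraph) (h1 h2 : half_edge X)
    (S1 : {set 'I_(nvert (smooth (vtx h1)))})
    (S2 : {set 'I_(nvert (smooth (vtx (mate h1))))}) :
  ncomp X = 1 -> bigon h1 h2 -> ~~ same_dir h1 h2 ->
  (forall h : half_edge (smooth (vtx h1)),
     (vtx (emb h) \in [set vtx (mate h1)]) = (vtx h \in S1)) ->
  (forall h : half_edge (smooth (vtx (mate h1))),
     (vtx (emb h) \in [set vtx h1]) = (vtx h \in S2)) ->
  fiso (delete S2) (delete S1).
Proof.
move=> X1 bh /negbTE sd S1E S2E; have /and3P[nv ad ad'] := bh.
have [/eqP ev /eqP ew] : vtx h1 == vtx h2 /\ vtx (mate h1) == vtx (mate h2).
  by case/andP: ad; case/andP: ad'.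
have U := bigon_uniq bh; split_uniq U.
have [t1 t2] := bigon_turn X1 bh.
have [t1' t2'] := bigon_turn X1 (bigon_mate bh).
rewrite bigon_same_dir // sd in t1' t2'; rewrite sd in t1 t2.
have pv := presents_smooth_delete (presents_self X) _ S1E.
have pw := presents_smooth_delete (presents_self X) _ S2E.
rewrite inE in pv; rewrite inE eq_sym in pw.
move: (pv nv) (pw nv) => {}pv {}pw.
have plv : placed [set vtx h1; vtx (mate h1)]
    (fun h : half_edge (delete S1) => emb (emb h)).
  exact: (placed_comp (@placed_emb X [set vtx h1]) (@placed_emb _ S1) S1E).
have plw : placed [set vtx h1; vtx (mate h1)]
    (fun h : half_edge (delete S2) => emb (emb h)).
  rewrite setUC.
  exact: (placed_comp (@placed_emb X [set vtx (mate h1)]) (@placed_emb _ S2) S2E).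
set v := vtx h1 in t1 t2 pv pw plv plw *.
set w := vtx (mate h1) in t1' t2' pv pw plv plw *.
set e1 := joined _ _ _ _ in pv; set e2 := joined _ _ _ _ in pw.
have [[sym1 _ _] [sym2 _ _]] := (pv, pw).
have edge1 : subrel (@edge X) e1 by move=> t u tu; do 2!apply: joined_rel.
have edge2 : subrel (@edge X) e2 by move=> t u tu; do 2!apply: joined_rel.
have j1 h k : vtx h = v -> turn v h = k -> connect e1 h k.
  by move=> hv hk; apply: connect_joined; apply: joined_connect hk; rewrite inE hv.
have o1 h k : vtx h = w -> opp h = k -> connect e1 h k.
  by move=> hw; apply: joined_connect; rewrite inE hw.
have j2 h k : vtx h = w -> turn w h = k -> connect e2 h k.
  by move=> hw hk; apply: connect_joined; apply: joined_connect hk; rewrite inE hw.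
have o2 h k : vtx h = v -> opp h = k -> connect e2 h k.
  by move=> hv; apply: joined_connect; rewrite inE hv.
have m1 h : connect e1 h (mate h) := edge_mate h edge1.
have m2 h : connect e2 h (mate h) := edge_mate h edge2.
have out1 : connect e1 (opp (mate h1)) (opp (mate h2)).
  apply: (connect_trans (o1 _ (mate h1) _ _)); rewrite ?oppK //.
  apply: (connect_trans (m1 _)); rewrite mateK.
  apply: (connect_trans (j1 _ _ _ t1)) => //.
  by apply: (connect_trans (m1 _)); apply: o1.
have out2 : connect e2 (opp h1) (opp h2).
  apply: (connect_trans (o2 _ h1 _ _)); rewrite ?oppK //.
  apply: (connect_trans (m2 _)).
  apply: (connect_trans (j2 _ _ _ t1')) => //.
  by apply: (connect_trans (m2 _)); rewrite mateK; apply: o2.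
have turn1 : connect e1 (opp h1) (opp h2) by apply: j1; rewrite ?turn_opp ?t1.
have turn2 : connect e2 (opp (mate h1)) (opp (mate h2)).
  by apply: j2; rewrite ?turn_opp ?t1'.
(* Both inner edges lie on the arc joining the two ends at w in the first
   graph, and at v in the second. *)
pose ps1 := [:: (h1, opp (mate h1)); (h2, opp (mate h1))].
pose ps2 := [:: (h1, opp h1); (h2, opp h1)].
have eqv : rel_equiv e1 e2 (collapse ps1) (collapse ps2).
  apply: (@collapse_equiv _ _ _ _ _ [:: h1; h2]) => //.
  - move=> p; rewrite !inE => /orP[]/eqP-> /=; apply/andP; split;
      try solve_outer.
      by apply: (connect_trans (m1 _)); apply: o1.
    by apply: (connect_trans (j1 _ _ _ t2)) => //; apply: (connect_trans (m1 _)); apply: o1.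
  - move=> p; rewrite !inE => /orP[]/eqP-> /=; apply/andP; split;
      try solve_outer.
      exact: o2.
    apply: (connect_trans (m2 _)); apply: (connect_trans (j2 _ _ _ t2')) => //.
    by apply: (connect_trans (m2 _)); rewrite mateK; apply: o2.
  - move=> t u /joinedP[/joinedP[|[h [hv -> ->]]]|[h [hw -> ->]]]; [by left| |].
      right; move: hv; rewrite inE => /eqP/(adjacentE ad)/or4P[]/eqP->;
        rewrite /= ?turn_opp ?t1 ?t2 /collapse /=; decide_eqs; rewrite ?connect0 //.
      by rewrite sym2.
    right; move: hw; rewrite inE => /eqP/(adjacentE ad')/or4P[]/eqP->;
      rewrite /= ?oppK /collapse /=; decide_eqs; rewrite ?connect0 //.
    by rewrite sym2.
  - move=> t u /joinedP[/joinedP[|[h [hv -> ->]]]|[h [hw -> ->]]]; [by left| |].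
      right; move: hv; rewrite inE => /eqP/(adjacentE ad')/or4P[]/eqP->;
        rewrite /= ?turn_opp ?t1' ?t2' /collapse /=; decide_eqs; rewrite ?connect0 //.
      by rewrite sym1.
    right; move: hw; rewrite inE => /eqP/(adjacentE ad)/or4P[]/eqP->;
      rewrite /= ?oppK /collapse /=; decide_eqs; rewrite ?connect0 //.
    by rewrite sym1.
have [|g gi _] := presents_iso pv pw plv plw eqv; last by exists g.
have [_ _ _ plvS _] := plv.
move=> h k <-; have := plvS h; move: (emb (emb h)) => l; rewrite !inE => /norP[lv lw].
have ne m : vtx l != vtx m -> (l == m) = false.
  by move=> lm; apply: contraNF lm => /eqP->.
by rewrite /collapse /= !ne -?ev -?ew // connect0.
Qed.

Lemma smooth_bigon_ends (X : fgraph) (h1 h2 : half_edge X) :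
  ncomp X = 1 -> bigon h1 h2 -> fequiv (smooth (vtx h1)) (smooth (vtx (mate h1))).
Proof.
move=> X1 bh; have [sd|sd] := boolP (same_dir h1 h2).
  exact/fequiv_sym/fequiv_iso/(smooth_bigon_parallel X1 bh sd).
have [S1 [S1E eq1]] := smooth_bigon_kink X1 bh sd.
have sd' : ~~ same_dir (mate h1) (mate h2) by rewrite bigon_same_dir.
have [S2 [S2E eq2]] := smooth_bigon_kink X1 (bigon_mate bh) sd'.
rewrite mateK in S2E.
apply: (fequiv_trans eq1); apply: (fequiv_trans _ (fequiv_sym eq2)).
exact/fequiv_sym/fequiv_iso/(smooth_bigon_antiparallel X1 bh sd S1E S2E).
Qed.

(** * The triangle and its flip *)

Definition flip_perm (X : fgraph) (h1 h2 h3 : half_edge X) : {perm half_edge X} :=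
  (tperm (opp h1) (opp (mate h1)) * tperm (opp h2) (opp (mate h2))
   * tperm (opp h3) (opp (mate h3)))%g.

Section Triangle.
Variables (X : fgraph) (h1 h2 h3 : half_edge X).
Hypothesis tri : triangle h1 h2 h3.

Local Notation s := (flip_perm h1 h2 h3).
Local Notation inside := (inner [:: h1; h2; h3]).
Local Notation T := [set vtx h1; vtx h2; vtx h3].

Lemma triangle_adj : [/\ adjacent (mate h3) h1, adjacent (mate h1) h2
                       & adjacent (mate h2) h3].
Proof. by case/and4P: tri. Qed.

Lemma triangle_vtx : [/\ vtx (mate h3) = vtx h1, vtx (mate h1) = vtx h2
                       & vtx (mate h2) = vtx h3].
Proof. by have [/and3P[/eqP-> _ _] /and3P[/eqP-> _ _] /and3P[/eqP-> _ _]] := triangle_adj. Qed.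

Lemma triangle_neq : [/\ vtx h1 != vtx h2, vtx h1 != vtx h3 & vtx h2 != vtx h3].
Proof.
by case/and4P: tri; rewrite /= !inE negb_or andbT => /andP[/andP[-> ->] ->].
Qed.

Lemma triangle_uniq :
  uniq (corner (mate h3) h1 ++ corner (mate h1) h2 ++ corner (mate h2) h3).
Proof.
have [ad1 ad2 ad3] := triangle_adj; have [v1 v2 v3] := triangle_vtx.
have [n12 n13 n23] := triangle_neq.
do 2?apply: corners_uniq => //; first exact: corner_uniq.
  by rewrite /= !vtx_opp v2 v3 ![_ == vtx h2]eq_sym n23.
by rewrite /= !vtx_opp v1 v2 v3 ![_ == vtx h1]eq_sym n12 n13.
Qed.

Lemma insideE t :
  inside t = [|| t == h1, t == h2, t == h3, t == mate h1, t == mate h2 | t == mate h3].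
Proof. by rewrite /inner !inE !(inv_eq (@mateK X)) -!orbA. Qed.

(** A half-edge lies on the triangle, is opposite to one that does, or is away
from it; flip_perm moves only the second kind. *)
Lemma triangle_ind (P : half_edge X -> Prop) :
  (forall t, inside t -> P t) -> (forall t, inside (opp t) -> P t) ->
  (forall t, vtx t \notin T -> P t) -> forall t, P t.
Proof.
move=> Pi Po Pn t; have [tT|tn] := boolP (vtx t \in T); last exact: Pn.
have [ad1 ad2 ad3] := triangle_adj; have [v1 v2 v3] := triangle_vtx.
move: tT; rewrite !inE -orbA => /or3P[]/eqP ev.
- rewrite -v1 in ev; case/or4P: (adjacentE ad1 ev) => /eqP->;
  by [apply: Pi; rewrite insideE eqxx ?orbT|apply: Po; rewrite oppK insideE eqxx ?orbT].
- rewrite -v2 in ev; case/or4P: (adjacentE ad2 ev) => /eqP->;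
  by [apply: Pi; rewrite insideE eqxx ?orbT|apply: Po; rewrite oppK insideE eqxx ?orbT].
rewrite -v3 in ev; case/or4P: (adjacentE ad3 ev) => /eqP->;
by [apply: Pi; rewrite insideE eqxx ?orbT|apply: Po; rewrite oppK insideE eqxx ?orbT].
Qed.

Lemma inside_opp t : inside t -> inside (opp t) = false.
Proof.
have U := triangle_uniq.
split_uniq U.
rewrite insideE.
by case/or4P => [/eqP->|/eqP->|/eqP->|/or3P[]/eqP->]; rewrite insideE; decide_eqs.
Qed.

Lemma inside_vtx t : inside t -> vtx t \in T.
Proof.
have [v1 v2 v3] := triangle_vtx; rewrite insideE !inE.
by case/or4P => [/eqP->|/eqP->|/eqP->|/or3P[]/eqP->];
  rewrite ?v1 ?v2 ?v3 eqxx ?orbT.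
Qed.

Lemma flip_perm_out t : inside (opp t) = false -> s t = t.
Proof.
rewrite insideE !(inv_eq (@oppK _)) => /negbT; rewrite !negb_or.
case/and5P=> n1 n2 n3 m1 /andP[m2 m3].
by rewrite /flip_perm !permM !tpermD // eq_sym.
Qed.

Lemma flip_perm_in t : inside t -> s (opp t) = opp (mate t).
Proof.
have U := triangle_uniq.
split_uniq U.
rewrite insideE.
by case/or4P => [/eqP->|/eqP->|/eqP->|/or3P[]/eqP->];
  rewrite /flip_perm !permM ?mateK;
  repeat first [rewrite tpermL | rewrite tpermR
    | rewrite [tperm _ _ (opp _)]tpermD; [|by decide_eqs|by decide_eqs]].
Qed.

Lemma flip_perm_inside t : inside t -> s t = t.
Proof. by move=> ti; rewrite flip_perm_out // inside_opp. Qed.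

Lemma flip_permK : involutive s.
Proof.
move=> t; have [ti|/negbTE to] := boolP (inside (opp t)); last first.
  by rewrite !flip_perm_out.
rewrite -{1}(oppK t) flip_perm_in // flip_perm_in ?inner_mate // mateK.
by rewrite oppK.
Qed.

Lemma flip_perm_strand t : inside t ->
  [/\ s t = t, s (mate t) = mate t, s (opp t) = opp (mate t)
    & s (opp (mate t)) = opp t].
Proof.
move=> ti; have mti : inside (mate t) by rewrite inner_mate.
split; [exact: flip_perm_inside|exact: flip_perm_inside|exact: flip_perm_in|].
by rewrite (flip_perm_in mti) mateK.
Qed.

Lemma inside_edges : [/\ inside h1, inside h2 & inside h3].
Proof. by rewrite !insideE !eqxx ?orbT. Qed.

Lemma flip_permV t : (s^-1)%g t = s t.
Proof. by apply: (@perm_inj _ s); rewrite permKV flip_permK. Qed.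

Lemma flip_perm_vtx t : vtx t \notin T -> s t = t.
Proof. by move=> tT; rewrite flip_perm_out //; apply: contraNF tT => /inside_vtx. Qed.

Lemma mate_flip t : mate (f := flip h1 h2 h3) t = s (mate (s t)).
Proof. by rewrite -[s t]flip_permV. Qed.

Lemma mate_flip_inside t : inside t -> mate (f := flip h1 h2 h3) t = mate t.
Proof.
by move=> ti; rewrite mate_flip flip_perm_inside // flip_perm_inside ?inner_mate.
Qed.

Lemma triangle_flip : triangle (X := flip h1 h2 h3) h1 h2 h3.
Proof.
by rewrite /triangle !mate_flip_inside // insideE eqxx ?orbT.
Qed.

(** Conjugating by s does not change the strands: it only changes the order in
which each of them meets its two triangle vertices. *)
Lemma ncomp_flip : ncomp (flip h1 h2 h3) = ncomp X.
Proof.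
pose Y := flip h1 h2 h3.
suff compE : n_comp (@unicursal X) predT = n_comp (@unicursal Y) predT.
  by rewrite /ncomp compE.
have flip_opp (e : rel (half_edge X)) : connect_sym e ->
    (forall t, connect e t (opp t)) -> (forall t, inside t -> connect e t (mate t)) ->
    forall t, connect e (s t) (s (opp t)).
  move=> sym eo em t; elim/triangle_ind: t => t ti.
  - rewrite (flip_perm_inside ti) flip_perm_in //.
    exact: connect_trans (em _ ti) (eo _).
  - rewrite -{1}(oppK t) flip_perm_in // (flip_perm_inside ti) sym.
    exact: connect_trans (em _ ti) (eo _).
  by rewrite !flip_perm_vtx ?vtx_opp.
have um Z h : connect (@unicursal Z) h (mate h).
  by apply: connect1; rewrite /unicursal eqxx.
have uo Z h : connect (@unicursal Z) h (opp h).
  by apply: connect1; rewrite /unicursal eqxx orbT.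
apply: (n_comp_equiv (e1 := @unicursal X) (e2 := @unicursal Y) (r := s) (s := s)) => //.
- exact: unicursal_sym.
- exact: unicursal_sym.
split=> [t u|t u|t|t]; last 2 first.
- by rewrite flip_permK connect0.
- by rewrite flip_permK connect0.
- case/orP=> /eqP->.
    by have := um Y (s t); rewrite mate_flip flip_permK.
  apply: flip_opp (@unicursal_sym Y) (uo Y) _ t => l li.
  by rewrite -mate_flip_inside //; apply: um.
case/orP=> /eqP->; last exact: flip_opp (@unicursal_sym X) (uo X) (fun l _ => um X l) t.
by rewrite mate_flip flip_permK; apply: um.
Qed.

(** Along each strand the triangle edge is now traversed in the other direction,
so all four half-edges at each vertex of the triangle reverse together. *)
Lemma same_dir_flip (h k : half_edge X) : ncomp X = 1 -> vtx h = vtx k ->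
  same_dir (X := flip h1 h2 h3) h k = same_dir (X := X) h k.
Proof.
move=> X1 hk; have Y1 : ncomp (flip h1 h2 h3) = 1 by rewrite ncomp_flip.
(* The direction of every outer edge is kept. *)
pose o t := if vtx t \in T then ~~ same_dir h t else same_dir h t.
have os t : o (s t) = if inside t then ~~ same_dir h t else same_dir h t.
  elim/triangle_ind: t => t ti; rewrite /o.
  - by rewrite flip_perm_inside // ti inside_vtx.
  - have -> : s t = opp (mate (opp t)) by rewrite -{1}(oppK t) flip_perm_in.
    have -> : inside t = false by rewrite -(oppK t) inside_opp.
    rewrite vtx_opp inside_vtx ?inner_mate // same_dir_oppE // same_dir_mate //.
    by rewrite same_dir_oppE // !negbK.
  rewrite flip_perm_vtx // (negbTE ti) ifF //.
  by apply: contraNF ti => /inside_vtx.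
rewrite (same_dir_unique Y1 (o := o)).
- rewrite /o hk; case: ifP => _; first rewrite (inj_eq negb_inj);
    by rewrite same_dir_refl; case: same_dir.
- move=> t; rewrite mate_flip os inner_mate same_dir_mate //.
  by rewrite -[in RHS](flip_permK t) os; case: ifP.
by move=> t; rewrite /o vtx_opp same_dir_oppE //; case: ifP.
Qed.

Lemma turn_flip c (h : half_edge X) : ncomp X = 1 ->
  turn (X := flip h1 h2 h3) c h = turn (X := X) c h.
Proof. by move=> X1; rewrite /turn same_dir_flip. Qed.

End Triangle.

(** * Smoothing and the third move *)

Lemma presents_flip (X : fgraph) (h1 h2 h3 : half_edge X) :
  triangle h1 h2 h3 ->
  presents (@edge X) (ncirc X) (flip_perm h1 h2 h3 : half_edge (flip h1 h2 h3) -> half_edge X).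
Proof.
move=> tri; have := presents_reroute (flip_perm h1 h2 h3) (presents_self X).
by rewrite (_ : (fun h => _) = flip_perm h1 h2 h3) //; apply/funext=> h; apply: flip_permV.
Qed.

(** The flip drawn on the half-edges of X: each outer half-edge of the triangle
sits at the other end of its strand. *)
Lemma flip_presentation (X : fgraph) (h1 h2 h3 : half_edge X) :
  triangle h1 h2 h3 -> exists s : half_edge X -> half_edge X,
  [/\ presents (@edge X) (ncirc X) (s : half_edge (flip h1 h2 h3) -> half_edge X),
      forall l, inner [:: h1; h2; h3] l ->
        [/\ s l = l, s (mate l) = mate l, s (opp l) = opp (mate l)
          & s (opp (mate l)) = opp l]
    & forall l, vtx l \notin [set vtx h1; vtx h2; vtx h3] -> s l = l].
Proof.
move=> tri; exists (flip_perm h1 h2 h3); split; first exact: presents_flip.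
  by move=> l; apply: flip_perm_strand.
by move=> l; apply: flip_perm_vtx.
Qed.

(** The triangle survives the smoothing at c, and the permutation s fixes the
half-edges at c. *)
Lemma smooth_flip_out (X : fgraph) (h1 h2 h3 : half_edge X) (c : 'I_(nvert X)) :
  ncomp X = 1 -> triangle h1 h2 h3 -> c \notin [set vtx h1; vtx h2; vtx h3] ->
  fequiv (smooth c) (@smooth (flip h1 h2 h3) c).
Proof.
move=> X1 tri cT; have [v1 v2 v3] := triangle_vtx tri.
have : c \notin [set vtx h1; vtx h2; vtx h3] by [].
rewrite !inE !negb_or => /andP[/andP[c1 c2] c3].
have [k1 ek1] : exists k : half_edge (smooth c), emb k = h1.
  by apply: emb_onto; rewrite inE eq_sym.
have [k2 ek2] : exists k : half_edge (smooth c), emb k = h2.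
  by apply: emb_onto; rewrite inE eq_sym.
have [k3 ek3] : exists k : half_edge (smooth c), emb k = h3.
  by apply: emb_onto; rewrite inE eq_sym.
have em1 : emb (mate k1) = mate h1 by rewrite emb_mate ek1 // v2 inE eq_sym.
have em2 : emb (mate k2) = mate h2 by rewrite emb_mate ek2 // v3 inE eq_sym.
have em3 : emb (mate k3) = mate h3 by rewrite emb_mate ek3 // v1 inE eq_sym.
have trik : triangle k1 k2 k3.
  have := tri; rewrite /triangle /= !inE -em1 -em2 -em3 -ek1 -ek2 -ek3 !vtx_emb.
  by rewrite !(placed_adjacent (@placed_emb X [set c])).
apply: (fequiv_trans (fequiv_R3 trik)); apply: fequiv_iso.
pose s := flip_perm h1 h2 h3; pose sk := flip_perm k1 k2 k3.
have emb_sk (l : half_edge (smooth c)) : emb ((sk^-1)%g l) = s (emb l).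
  rewrite flip_permV // /s /sk /flip_perm !permM !(inj_tperm _ _ _ (@emb_inj X [set c])).
  by rewrite !emb_opp em1 em2 em3 ek1 ek2 ek3.
have p1 := presents_reroute sk (presents_smooth c (presents_self X)).
have p2 := presents_smooth (X := flip h1 h2 h3) c (presents_flip tri).
have pl1 : placed [set c] (fun h : half_edge (reroute sk) => emb h) := @placed_emb X [set c].
have pl2 : placed [set c] (fun h : half_edge (@smooth (flip h1 h2 h3) c) => emb h)
  := @placed_emb (flip h1 h2 h3) [set c].
have [t u|h k|g gi _] := presents_eq_iso p2 p1 pl2 pl1; last by exists g.
  have fix_c l : vtx l = c -> s l = l by move=> lc; apply: flip_perm_vtx; rewrite ?lc.
  congr (_ || _); apply: eq_existsb => l; rewrite inE.
  have [lc|//] := eqVneq (vtx l) c.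
  by rewrite /= turn_flip // !fix_c ?turn_vtx.
by move=> /= ->; apply/esym/emb_sk.
Qed.

Lemma adjacent_oppl n (h k : hedge n) : adjacent (opp h) k = adjacent h k.
Proof.
rewrite /adjacent vtx_opp oppK [opp h == k]eq_sym [h == k]eq_sym.
by rewrite [(k != opp h) && _]andbC.
Qed.

(** With h1 and mate h3 joined, the edges A -- B and C -- A become one edge, which
together with h2 forms a bigon between B and C. *)
Lemma smooth_triangle_bigon (X : fgraph) (h1 h2 h3 : half_edge X) :
  ncomp X = 1 -> triangle h1 h2 h3 -> turn (vtx h1) h1 = mate h3 ->
  exists S' : {set 'I_(nvert (smooth (vtx h1)))},
    (forall h : half_edge (smooth (vtx h1)),
       (vtx (emb h) \in [set vtx h2; vtx h3]) = (vtx h \in S')) /\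
    fequiv (smooth (vtx h1)) (delete S').
Proof.
move=> X1 tri t1; have [ad1 ad2 ad3] := triangle_adj tri.
have [v1 v2 v3] := triangle_vtx tri; have [n12 n13 n23] := triangle_neq tri.
set v := vtx h1 in t1 *.
have [k1 ek1] : exists k : half_edge (smooth v), emb k = mate h1.
  by apply: emb_onto; rewrite inE v2 eq_sym.
have [k2 ek2] : exists k : half_edge (smooth v), emb k = h2.
  by apply: emb_onto; rewrite inE eq_sym.
have [k3 ek3] : exists k : half_edge (smooth v), emb k = h3.
  by apply: emb_onto; rewrite inE eq_sym.
have em2 : emb (mate k2) = mate h2 by rewrite emb_mate ek2 // v3 inE eq_sym.
have [_ eE _] := presents_smooth v (presents_self X).
have := eE k1 k3; set e := joined _ _ _ _; rewrite ek1 ek3.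
have edge1 : subrel (@edge X) e by apply: joined_rel.
have -> : connect e (mate h1) h3.
  apply: (connect_trans (edge_mate _ edge1)); rewrite mateK -(mateK h3).
  apply: (connect_trans _ (edge_mate _ edge1)).
  by apply: joined_connect t1; rewrite inE.
have -> : k3 == k1 = false.
  rewrite -(inj_eq (@emb_inj _ _)) ek1 ek3 eq_sym.
  by apply: contraNF n23 => /eqP <-; rewrite v2.
move=> /esym/eqP em1.
have bk : bigon k2 k1.
  rewrite /bigon -em1 -vtx_emb -!(placed_adjacent (@placed_emb X [set v])).
  by rewrite em2 ek1 ek2 ek3 v3 n23 adjacent_sym ad2.
exists [set vtx k2; vtx (mate k2)]; split; last exact: fequiv_R2 bk.
by move=> h; rewrite !inE -!vtx_emb em2 ek2 v3.
Qed.

(** After the bigon is removed, strand 2 runs straight through, the beginning of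
strand 1 is joined to the end of strand 3 and the end of strand 1 to the
beginning of strand 3, both before and after the flip. *)
Lemma smooth_flip_bigon (X : fgraph) (h1 h2 h3 : half_edge X)
    (S1 : {set 'I_(nvert (smooth (vtx h1)))})
    (S2 : {set 'I_(nvert (@smooth (flip h1 h2 h3) (vtx h1)))}) :
  ncomp X = 1 -> triangle h1 h2 h3 -> turn (vtx h1) h1 = mate h3 ->
  (forall h : half_edge (smooth (vtx h1)),
     (vtx (emb h) \in [set vtx h2; vtx h3]) = (vtx h \in S1)) ->
  (forall h : half_edge (@smooth (flip h1 h2 h3) (vtx h1)),
     (vtx (emb h) \in [set vtx h2; vtx h3]) = (vtx h \in S2)) ->
  fiso (delete S2) (delete S1).
Proof.
move=> X1 tri t1 S1E S2E.
have [ad1 ad2 ad3] := triangle_adj tri; have [v1 v2 v3] := triangle_vtx tri.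
have [n12 n13 n23] := triangle_neq tri.
have [s [pY sI sout]] := flip_presentation tri.
have [i1 i2 i3] := inside_edges h1 h2 h3.
have [s1 s1m s1o s1om] := sI _ i1; have [s2 s2m s2o s2om] := sI _ i2.
have [s3 s3m s3o s3om] := sI _ i3.
have t3 : turn (vtx h1) (mate h3) = h1 by rewrite -t1 turnK.
have vn : vtx h1 \notin [set vtx h2; vtx h3] by rewrite !inE negb_or n12 n13.
have pv := presents_smooth_delete (presents_self X) vn S1E.
have pw := presents_smooth_delete pY vn S2E.
have plv : placed [set vtx h1; vtx h2; vtx h3]
    (fun h : half_edge (delete S1) => emb (emb h)).
  rewrite -setUA.
  exact: (placed_comp (@placed_emb X [set vtx h1]) (@placed_emb _ S1) S1E).
have plw : placed [set vtx h1; vtx h2; vtx h3]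
    (fun h : half_edge (delete S2) => emb (emb h)).
  rewrite -setUA.
  exact: (placed_comp (@placed_emb (flip h1 h2 h3) [set vtx h1]) (@placed_emb _ S2) S2E).
set e1 := joined _ _ _ _ in pv; set e2 := joined _ _ _ _ in pw.
have [[sym1 _ _] [sym2 _ _]] := (pv, pw).
have edge1 : subrel (@edge X) e1 by move=> t u tu; do 2!apply: joined_rel.
have edge2 : subrel (@edge X) e2 by move=> t u tu; do 2!apply: joined_rel.
have j1 h k : vtx h = vtx h1 -> turn (vtx h1) h = k -> connect e1 h k.
  by move=> hv hk; apply: connect_joined; apply: joined_connect hk; rewrite inE hv.
have o1 h : vtx h \in [set vtx h2; vtx h3] -> connect e1 h (opp h).
  by move=> hw; apply: joined_connect.
have j2 h : vtx h = vtx h1 -> connect e2 (s h) (s (turn (vtx h1) h)).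
  move=> hv; apply: connect_joined; apply: connect1; rewrite -(turn_flip tri) //.
  by apply: (@joined_J _ _ (flip h1 h2 h3)); rewrite inE hv.
have o2 h : vtx h \in [set vtx h2; vtx h3] -> connect e2 (s h) (s (opp h)).
  by move=> hw; apply: connect1; apply: (@joined_J _ _ (flip h1 h2 h3)).
have m1 h : connect e1 h (mate h) := edge_mate h edge1.
have m2 h : connect e2 h (mate h) := edge_mate h edge2.
have a1 : connect e1 h1 (mate h3) by apply: j1.
have b1 : connect e1 (opp h1) (opp (mate h3)) by apply: j1; rewrite ?turn_opp ?t1.
have c1 : connect e1 (mate h1) (opp (mate h1)) by apply: o1; rewrite v2 !inE eqxx.
have d1 : connect e1 h2 (opp h2) by apply: o1; rewrite !inE eqxx.
have f1 : connect e1 (mate h2) (opp (mate h2)) by apply: o1; rewrite v3 !inE eqxx orbT.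
have g1 : connect e1 h3 (opp h3) by apply: o1; rewrite !inE eqxx orbT.
have a2 : connect e2 h1 (mate h3) by have := j2 h1 erefl; rewrite t1 s1 s3m.
have b2 : connect e2 (opp (mate h1)) (opp h3).
  by have := j2 (opp h1) erefl; rewrite turn_opp t1 s1o s3om.
have c2 : connect e2 (mate h1) (opp h1).
  by rewrite -{1}s1m -s1om; apply: o2; rewrite v2 !inE eqxx.
have d2 : connect e2 h2 (opp (mate h2)) by rewrite -{1}s2 -s2o; apply: o2; rewrite !inE eqxx.
have f2 : connect e2 (mate h2) (opp h2).
  by rewrite -{1}s2m -s2om; apply: o2; rewrite v3 !inE eqxx orbT.
have g2 : connect e2 h3 (opp (mate h3)).
  by rewrite -{1}s3 -s3o; apply: o2; rewrite !inE eqxx orbT.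
have out1 : connect e1 (opp (mate h1)) (opp h3).
  rewrite sym1; apply: (connect_trans _ c1); rewrite sym1.
  have := connect_trans a1 (m1 _); rewrite mateK => h13.
  by apply: connect_trans (connect_trans h13 g1); rewrite sym1.
have out1' : connect e1 (opp (mate h2)) (opp h2).
  by apply: connect_trans d1; rewrite sym1; apply: connect_trans (m1 _) f1.
have out2 : connect e2 (opp h1) (opp (mate h3)).
  rewrite sym2; apply: (connect_trans _ c2); rewrite sym2.
  have := connect_trans a2 (m2 _); rewrite mateK => h13.
  by apply: connect_trans (connect_trans h13 g2); rewrite sym2.
have out2' : connect e2 (opp h2) (opp (mate h2)).
  by apply: connect_trans d2; rewrite sym2; apply: connect_trans (m2 _) f2.
have U := triangle_uniq tri; split_uniq U.
(* The edges of h1 and h3 are joined at A; one of the outer half-edges on their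
   arc is opp h3 before the flip and opp h1 after it. *)
pose ps1 := [:: (h1, opp h3); (h3, opp h3); (h2, opp h2)].
pose ps2 := [:: (h1, opp h1); (h3, opp h1); (h2, opp (mate h2))].
have eqv : rel_equiv e1 e2 (collapse ps1) (collapse ps2).
  apply: (@collapse_equiv _ _ _ _ _ [:: h1; h3; h2]) => //.
  - move=> p; rewrite !inE => /or3P[]/eqP-> /=; apply/andP; split=> //;
      try solve_outer.
    by apply: (connect_trans a1); apply: connect_trans (m1 _) _; rewrite mateK.
  - move=> p; rewrite !inE => /or3P[]/eqP-> /=; apply/andP; split=> //;
      try solve_outer.
      by apply: connect_trans (m2 _) c2.
    apply: (connect_trans (m2 _)); rewrite sym2 in a2.
    by apply: (connect_trans a2); apply: connect_trans (m2 _) c2.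
  - move=> t u /joinedP[/joinedP[|[h [hv -> ->]]]|[h [hw -> ->]]]; [by left| |];
      right.
      move: hv; rewrite inE -v1 => /eqP/(adjacentE ad1)/or4P[]/eqP->;
        rewrite /= ?turn_opp v1 ?t1 ?t3 /collapse /=; decide_eqs; rewrite ?connect0 //.
      by rewrite sym2.
    move: hw; rewrite !inE -{1}v2 -v3 => /orP[]/eqP;
      [move/(adjacentE ad2)|move/(adjacentE ad3)] => /or4P[]/eqP->;
      rewrite /= ?oppK /collapse /=; decide_eqs; rewrite ?connect0 //;
      by rewrite sym2.
  - move=> t u /joinedP[/joinedP[|[h [hv -> ->]]]|[h [hw -> ->]]]; [by left| |];
      right.
      rewrite (turn_flip tri) //; move: hv; rewrite inE -v1 => /eqP/(adjacentE ad1)/or4P[]/eqP->;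
        rewrite /= ?turn_opp v1 ?t1 ?t3 ?(s1, s1o, s3m, s3om) /collapse /=;
        decide_eqs; rewrite ?connect0 //.
      by rewrite sym1.
    move: hw; rewrite !inE -{1}v2 -v3 => /orP[]/eqP;
      [move/(adjacentE ad2)|move/(adjacentE ad3)] => /or4P[]/eqP->;
      rewrite /= ?oppK ?(s1m, s1om, s2, s2o, s2m, s2om, s3, s3o) /collapse /=;
      decide_eqs; rewrite ?connect0 //; by rewrite sym1.
have [|g gi _] := presents_iso pv pw plv plw eqv; last by exists g.
have [_ _ _ plvS _] := plv.
move=> h k <-; have := plvS h; move: (emb (emb h)) => l lT.
have ne m : vtx m \in [set vtx h1; vtx h2; vtx h3] -> (l == m) = false.
  by move=> mT; apply: contraNF lT => /eqP->.
by rewrite sout // /collapse /= !ne ?connect0 // !inE ?v1 ?v2 ?v3 eqxx ?orbT.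
Qed.

(** The two crossings left lie on strand 2: it first crosses an arc joining the
ends of strands 1 and 3, then one joining their beginnings.  These crossings
sit at B and C before the flip, at C and B after it. *)
Lemma smooth_flip_swap (X : fgraph) (h1 h2 h3 : half_edge X) :
  ncomp X = 1 -> triangle h1 h2 h3 -> turn (vtx h1) h1 = opp (mate h3) ->
  fiso (@smooth (flip h1 h2 h3) (vtx h1)) (smooth (vtx h1)).
Proof.
move=> X1 tri t1.
have [ad1 ad2 ad3] := triangle_adj tri; have [v1 v2 v3] := triangle_vtx tri.
have [n12 n13 n23] := triangle_neq tri.
have [s [pY sI sout]] := flip_presentation tri.
have [i1 i2 i3] := inside_edges h1 h2 h3.
have [s1 s1m s1o s1om] := sI _ i1; have [s2 s2m s2o s2om] := sI _ i2.
have [s3 s3m s3o s3om] := sI _ i3.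
have t3 : turn (vtx h1) (mate h3) = opp h1 by rewrite -[mate h3]oppK -t1 turn_opp turnK.
have pv := presents_smooth (vtx h1) (presents_self X).
have pw := presents_smooth (vtx h1 : 'I_(nvert (flip h1 h2 h3))) pY.
set e1 := joined _ _ _ _ in pv; set e2 := joined _ _ _ _ in pw.
have [[sym1 _ _] [sym2 _ _]] := (pv, pw).
have edge1 : subrel (@edge X) e1 by apply: joined_rel.
have edge2 : subrel (@edge X) e2 by apply: joined_rel.
have j1 h k : vtx h = vtx h1 -> turn (vtx h1) h = k -> connect e1 h k.
  by move=> hv hk; apply: joined_connect hk; rewrite inE hv.
have j2 h : vtx h = vtx h1 -> connect e2 (s h) (s (turn (vtx h1) h)).
  move=> hv; apply: connect1; rewrite -(turn_flip tri) //.
  by apply: (@joined_J _ _ (flip h1 h2 h3)); rewrite inE hv.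
have m1 h : connect e1 h (mate h) := edge_mate h edge1.
have m2 h : connect e2 h (mate h) := edge_mate h edge2.
have a1 : connect e1 h1 (opp (mate h3)) by apply: j1.
have b1 : connect e1 (mate h3) (opp h1) by apply: j1.
have a2 : connect e2 h1 (opp h3) by have := j2 h1 erefl; rewrite t1 s1 s3om.
have b2 : connect e2 (mate h3) (opp (mate h1)).
  by have := j2 (mate h3) v1; rewrite t3 s3m s1o.
have U := triangle_uniq tri; split_uniq U.
(* The edge of h2 is kept: it joins B and C in both smoothings. *)
pose ps1 := [:: (h1, opp (mate h3)); (h3, opp h1)].
pose ps2 := [:: (h1, opp h3); (h3, opp (mate h1))].
have eqv : rel_equiv e1 e2 (collapse ps1) (collapse ps2).
  apply: (@collapse_equiv _ _ _ _ _ [:: h1; h3]) => //.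
  - move=> p; rewrite !inE => /orP[]/eqP-> /=; apply/andP; split; try solve_outer.
      exact: a1.
    exact: connect_trans (m1 _) b1.
  - move=> p; rewrite !inE => /orP[]/eqP-> /=; apply/andP; split; try solve_outer.
      exact: a2.
    exact: connect_trans (m2 _) b2.
  - move=> t u /joinedP[|[h [hv -> ->]]]; [by left|right].
    by move: hv; rewrite inE -v1 => /eqP/(adjacentE ad1)/or4P[]/eqP->;
      rewrite /= ?turn_opp v1 ?t1 ?t3 ?oppK /collapse /=; decide_eqs; rewrite connect0.
  move=> t u /joinedP[|[h [hv -> ->]]]; [by left|right].
  rewrite (turn_flip tri) //; move: hv; rewrite inE -v1 => /eqP/(adjacentE ad1)/or4P[]/eqP->;
    rewrite v1.
  - by rewrite t3 s3m s1o /collapse /=; decide_eqs; rewrite connect0.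
  - by rewrite turn_opp t3 oppK s3om s1 /collapse /=; decide_eqs; rewrite connect0.
  - by rewrite t1 s1 s3om /collapse /=; decide_eqs; rewrite connect0.
  by rewrite turn_opp t1 oppK s1o s3m /collapse /=; decide_eqs; rewrite connect0.
have ads : adjacent h3 (mate h2) by rewrite adjacent_sym.
have ads' : adjacent (opp (mate h1)) h2 by rewrite adjacent_oppl.
have nv : vtx h3 != vtx (opp (mate h1)) by rewrite vtx_opp v2 eq_sym.
have [F [pF vF [Fa Fb Fa' Fb'] Fout]] := corner_swap ads ads' nv.
have Fo l : F (opp l) = opp (F l) by case: pF.
have Fam : F (mate h1) = opp h3 by rewrite -[mate h1]oppK Fo Fa'.
have plv : placed (set0 :|: [set vtx h1])
    (fun h : half_edge (smooth (vtx h1)) => F (emb h)).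
  apply: (placed_comp pF (@placed_emb X [set vtx h1])) => h.
  rewrite !inE vF -{1}(tpermD (x := vtx h3) (y := vtx (opp (mate h1))) (z := vtx h1)).
  - by rewrite (inj_eq perm_inj).
  - by rewrite eq_sym.
  by rewrite vtx_opp v2 eq_sym.
rewrite set0U in plv.
have plw : placed [set vtx h1] (fun h : half_edge (@smooth (flip h1 h2 h3) (vtx h1)) => emb h)
  := @placed_emb (flip h1 h2 h3) [set vtx h1].
have [|g gi _] := presents_iso pv pw plv plw eqv; last by exists g.
move=> h k <-; have hv := emb_kept h; move: (emb h) hv => l; rewrite /kept inE /= => lv.
have [|l2] := eqVneq (vtx l) (vtx h2).
  rewrite -v2 => /(adjacentE ad2)/or4P[]/eqP->.
  - by rewrite Fam s3o /collapse /=; decide_eqs; rewrite connect0.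
  - rewrite Fa' s3 /collapse /=; decide_eqs.
    by rewrite sym2; apply: connect_trans (m2 _) b2.
  - by rewrite Fb' s2m /collapse /=; decide_eqs; apply: m2.
  by rewrite Fo Fb' s2om /collapse /=; decide_eqs; rewrite connect0.
have [|l3] := eqVneq (vtx l) (vtx h3).
  rewrite -v3 => /(adjacentE ad3)/or4P[]/eqP->.
  - by rewrite Fb s2 /collapse /=; decide_eqs; rewrite sym2; apply: m2.
  - by rewrite Fo Fb s2o /collapse /=; decide_eqs; rewrite connect0.
  - by rewrite Fa s1om /collapse /=; decide_eqs; rewrite connect0.
  rewrite Fo Fa oppK s1m /collapse /=; decide_eqs.
  by rewrite sym2 in a2; apply: connect_trans a2 (m2 _).
rewrite (Fout _ l3); last by rewrite vtx_opp v2.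
rewrite sout; last by rewrite !inE !negb_or lv l2 l3.
have ne m : vtx l != vtx m -> (l == m) = false.
  by move=> lm; apply: contraNF lm => /eqP->.
by rewrite /collapse /= !ne ?v1 ?v2 ?connect0.
Qed.

Lemma smooth_flip_corner (X : fgraph) (h1 h2 h3 : half_edge X) :
  ncomp X = 1 -> triangle h1 h2 h3 ->
  fequiv (smooth (vtx h1)) (@smooth (flip h1 h2 h3) (vtx h1)).
Proof.
move=> X1 tri; have [ad1 _ _] := triangle_adj tri.
have := turnE X1 (etrans (adjacent_sym _ _) ad1); case: ifP => _ t1.
  exact/fequiv_sym/fequiv_iso/smooth_flip_swap.
have [S1 [S1E eq1]] := smooth_triangle_bigon X1 tri t1.
have [Y1 triY] := (ncomp_flip tri, triangle_flip tri); rewrite X1 in Y1.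
have t1Y : turn (X := flip h1 h2 h3) (vtx h1) h1 = mate (f := flip h1 h2 h3) h3.
  by rewrite turn_flip // t1 mate_flip_inside // insideE eqxx ?orbT.
have [S2 [S2E eq2]] := smooth_triangle_bigon Y1 triY t1Y.
apply: (fequiv_trans eq1); apply: (fequiv_trans _ (fequiv_sym eq2)).
exact/fequiv_sym/fequiv_iso/(smooth_flip_bigon X1 tri t1 S1E S2E).
Qed.

Lemma triangle_rot (X : fgraph) (h1 h2 h3 : half_edge X) :
  triangle h1 h2 h3 -> triangle h2 h3 h1.
Proof.
case/and4P=> u ad1 ad2 ad3; rewrite /triangle ad1 ad2 ad3 !andbT.
by rewrite -(rot_uniq 2).
Qed.

(** The three transpositions are disjoint, hence commute. *)
Lemma flip_perm_rot (X : fgraph) (h1 h2 h3 : half_edge X) :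
  triangle h1 h2 h3 -> flip_perm h2 h3 h1 = flip_perm h1 h2 h3.
Proof.
move=> tri; have tri' := triangle_rot tri.
have inE' t : inner [:: h2; h3; h1] t = inner [:: h1; h2; h3] t.
  by rewrite /inner !(mem_rot 1 [:: h1; h2; h3]).
apply/perm.permP=> t; elim/(triangle_ind tri): t => t ti.
- by rewrite !flip_perm_inside // inE'.
- by rewrite -(oppK t) !flip_perm_in // inE'.
rewrite !flip_perm_vtx //; apply: contra ti; rewrite !inE.
by case/orP=> [/orP[]|] ->; rewrite ?orbT.
Qed.

Lemma smooth_flip (X : fgraph) (h1 h2 h3 : half_edge X) (c : 'I_(nvert X)) :
  ncomp X = 1 -> triangle h1 h2 h3 ->
  fequiv (smooth c) (@smooth (flip h1 h2 h3) c).
Proof.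
move=> X1 tri; have tri2 := triangle_rot tri; have tri3 := triangle_rot tri2.
have [|cT] := boolP (c \in [set vtx h1; vtx h2; vtx h3]); last exact: smooth_flip_out.
rewrite !inE -orbA => /or3P[]/eqP->; first exact: smooth_flip_corner.
  have : fequiv (smooth (vtx h2))
      (@smooth (reroute (flip_perm h2 h3 h1)) (vtx h2)) := smooth_flip_corner X1 tri2.
  by rewrite (flip_perm_rot tri).
have : fequiv (smooth (vtx h3))
    (@smooth (reroute (flip_perm h3 h1 h2)) (vtx h3)) := smooth_flip_corner X1 tri3.
by rewrite (flip_perm_rot tri2) (flip_perm_rot tri).
Qed.

(** * Invariance of the sums *)

Lemma smooth_link_eq (X Y : fgraph) (X1 : ncomp X = 1) (Y1 : ncomp Y = 1) c c' :
  fequiv (@smooth X c) (@smooth Y c') -> smooth_link X1 c = smooth_link Y1 c'.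
Proof.
move=> cc'; apply: val_inj => /=; apply/funext=> Z; apply/propext.
by split; apply: fequiv_trans; [apply: fequiv_sym|].
Qed.

Lemma addvv_F2 (V : lmodType 'F_2) (v : V) : (v + v = 0)%R.
Proof.
rewrite -GRing.mulr2n -GRing.scaler_nat.
by rewrite [X in GRing.scale X v](_ : _ = 0%R) ?GRing.scale0r //; apply/eqP.
Qed.

Lemma deletion_placed (X Y : fgraph) (S : {set 'I_(nvert X)})
    (f : half_edge Y -> half_edge X) : is_deletion S f -> placed S f.
Proof.
case=> u ui fE; have pu := placed_fiso ui.
have : placed (S :|: set0) (fun h => emb (u h)).
  by apply: (placed_comp (@placed_emb X S) pu) => h; rewrite !inE.
by rewrite setU0 (_ : (fun h => emb (u h)) = f) //; apply/funext=> h; rewrite fE.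
Qed.

Lemma smooth_deletion (X Y : fgraph) (S : {set 'I_(nvert X)})
    (f : half_edge Y -> half_edge X) c c' :
  ncomp X = 1 -> is_deletion S f -> c \notin S ->
  (forall h, (vtx (f h) == c) = (vtx h == c')) ->
  (forall d : 'I_(nvert (delete S)),
     (forall k : half_edge (delete S), (vtx (emb k) == c) = (vtx k == d)) ->
     fequiv (smooth c) (smooth d)) ->
  fequiv (smooth c) (smooth c').
Proof.
move=> X1 [u ui fE] cS cc' cd.
have [l el] : exists l : half_edge (delete S), emb l = (c, true, true).
  by apply: emb_onto.
have ld (k : half_edge (delete S)) : (vtx (emb k) == c) = (vtx k == vtx l).
  by rewrite -vtx_emb el.
apply: (fequiv_trans (cd _ ld)); apply: fequiv_iso.
apply: smooth_fiso ui _; first by rewrite ncomp_delete.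
by move=> h; rewrite -ld -fE cc'.
Qed.

Section Delta.
Variables (G : groupType) (P : pred G).
Hypotheses (P1 : ~~ P 1%g) (PV : forall g, P g^-1%g = P g).

(** The sum over g and its inverse and the sum over all nontrivial labels are
both of this form, for a set of labels closed under inversion and without 1. *)
Definition Delta_on (X : ggraph G) (X1 : ncomp X = 1) : flink2_space :=
  (\sum_(c | P (label c)) << smooth_link X1 c >>)%R.

(** Common to all moves: the vertices of Y are the vertices of X outside S, and
corresponding smoothings agree. *)
Lemma Delta_placed (X Y : ggraph G) (X1 : ncomp X = 1) (Y1 : ncomp Y = 1)
    (S : {set 'I_(nvert X)}) (f : half_edge Y -> half_edge X) :
  placed S f -> (forall h, P (label (vtx (f h))) = P (label (vtx h))) ->
  (forall c c', c \notin S -> (forall h, (vtx (f h) == c) = (vtx h == c')) ->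
     fequiv (smooth c) (smooth c')) ->
  Delta_on Y1 = (\sum_(c | P (label c) && (c \notin S)) << smooth_link X1 c >>)%R.
Proof.
move=> [_ _ fv fS fim] fP fc.
pose fvtx (c : 'I_(nvert Y)) := vtx (f (c, true, true)).
have fvtxE h c : (vtx (f h) == fvtx c) = (vtx h == c) by rewrite fv.
rewrite (@reindex_omap _ _ _ _ _ fvtx (fun c => [pick c' | fvtx c' == c])).
  apply: eq_big => [c|c _].
    rewrite fP fS andbT; case: pickP => [c'|/(_ c)]; last by rewrite eqxx.
    by rewrite fvtxE => /eqP <-; rewrite eqxx andbT.
  by congr << _ >>%R; apply/esym/smooth_link_eq/fc; [apply: fS|].
move=> c /andP[_ cS]; case: pickP => [c' /eqP /= -> //|].
have [h eh] := fim (c, true, true) cS.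
by move/(_ (vtx h)); rewrite eq_sym -[c]/(vtx (c, true, true)) -eh fvtxE eqxx.
Qed.

Lemma Delta_split (X : ggraph G) (X1 : ncomp X = 1) (S : {set 'I_(nvert X)}) :
  (\sum_(c | P (label c) && (c \in S)) << smooth_link X1 c >> = 0 :> flink2_space)%R ->
  Delta_on X1 = (\sum_(c | P (label c) && (c \notin S)) << smooth_link X1 c >>)%R.
Proof. by move=> S0; rewrite /Delta_on (bigID (mem S)) /= S0 GRing.add0r. Qed.

Lemma Delta_giso (X Y : ggraph G) (X1 : ncomp X = 1) (Y1 : ncomp Y = 1) :
  giso X Y -> Delta_on X1 = Delta_on Y1.
Proof.
case=> f [fi [_ fl]]; rewrite (Delta_placed X1 Y1 (placed_fiso fi)).
- by apply: eq_bigl => c; rewrite inE andbT.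
- by move=> h; rewrite fl.
by move=> c c' _ cc'; apply: fequiv_iso; apply: smooth_fiso fi cc'.
Qed.

Lemma Delta_gR1 (X Y : ggraph G) (X1 : ncomp X = 1) (Y1 : ncomp Y = 1) :
  gR1 X Y -> Delta_on X1 = Delta_on Y1.
Proof.
case=> h [f [kh l1 fd [_ fl]]]; rewrite (Delta_placed X1 Y1 (deletion_placed fd)).
- apply: Delta_split; rewrite big_pred0 // => c; rewrite inE.
  by case: eqP => [->|]; rewrite ?andbF // l1 (negbTE P1).
- by move=> k; rewrite fl.
move=> c c' cS cc'; apply: (smooth_deletion X1 fd cS cc') => d cd.
exact: smooth_kink cd.
Qed.

Lemma Delta_gR2 (X Y : ggraph G) (X1 : ncomp X = 1) (Y1 : ncomp Y = 1) :
  gR2 X Y -> Delta_on X1 = Delta_on Y1.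
Proof.
case=> h1 [h2 [f [bh lV fd [_ fl]]]]; rewrite (Delta_placed X1 Y1 (deletion_placed fd)).
- apply: Delta_split; have nv : vtx h1 != vtx (mate h1) by case/and3P: bh.
  have PP : P (label (vtx (mate h1))) = P (label (vtx h1)) by rewrite lV PV.
  have [Ph|Ph] := boolP (P (label (vtx h1))); last first.
    by apply: big_pred0 => c; rewrite !inE; apply/negP=> /andP[Pc /orP[]/eqP ec];
      move: Pc; rewrite ec ?PP (negbTE Ph).
  rewrite (eq_bigl (mem [set vtx h1; vtx (mate h1)])); last first.
    by move=> c /=; rewrite !inE andb_idl // => /orP[]/eqP->; rewrite ?PP.
  rewrite big_setU1 ?inE //= big_set1.
  rewrite (smooth_link_eq X1 X1 (smooth_bigon_ends X1 bh)).
  exact: (@addvv_F2 flink2_space).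
- by move=> k; rewrite fl.
move=> c c' cS cc'; apply: (smooth_deletion X1 fd cS cc') => d cd.
exact: (smooth_bigon X1 bh cS cd).
Qed.

Lemma Delta_gR3 (X Y : ggraph G) (X1 : ncomp X = 1) (Y1 : ncomp Y = 1) :
  gR3 X Y -> Delta_on X1 = Delta_on Y1.
Proof.
case=> h1 [h2 [h3 [f [[tri _] _ fi _ fl]]]].
have Z1 : ncomp (flip h1 h2 h3) = 1 by rewrite ncomp_flip.
rewrite (@Delta_placed X Y X1 Y1 set0 f (placed_fiso fi)).
- by apply: eq_bigl => c; rewrite inE andbT.
- by move=> h; rewrite fl; case: ifP; rewrite ?PV.
move=> c c' _ cc'; apply: (fequiv_trans (smooth_flip c X1 tri)).
by apply: fequiv_iso; apply: (@smooth_fiso (flip h1 h2 h3) Y f).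
Qed.

Lemma gequiv_step_ncomp (X Y : ggraph G) :
  [\/ giso X Y, gR1 X Y, gR2 X Y | gR3 X Y] -> ncomp Y = ncomp X.
Proof.
case=> [[f [fi _]]|[h [f [_ _ [u ui _] _]]]|[h1 [h2 [f [_ _ [u ui _] _]]]]
       |[h1 [h2 [h3 [f [[tri _] _ fi _ _]]]]]].
- exact: ncomp_fiso fi.
- by rewrite (ncomp_fiso ui) ncomp_delete.
- by rewrite (ncomp_fiso ui) ncomp_delete.
by rewrite (ncomp_fiso fi) ncomp_flip.
Qed.

(** The intermediate graphs of a chain of moves have one component as well, so
that their sums make sense. *)
Lemma Delta_gequiv (X Y : ggraph G) : gequiv X Y ->
  ncomp X = ncomp Y /\
  forall (X1 : ncomp X = 1) (Y1 : ncomp Y = 1), Delta_on X1 = Delta_on Y1.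
Proof.
elim=> {X Y} [X Y XY|X|X Y _ [XY1 XYD]|X Y Z _ [XY1 XYD] _ [YZ1 YZD]].
- split=> [|X1 Y1]; first by rewrite (gequiv_step_ncomp XY).
  case: XY; [exact: Delta_giso|exact: Delta_gR1|exact: Delta_gR2|exact: Delta_gR3].
- by split=> // X1 X1'; rewrite (eq_irrelevance X1 X1').
- by split=> // Y1 X1; rewrite XYD.
split=> [|X1 Z1]; first by rewrite XY1.
by have Y1 : ncomp Y = 1; [rewrite -XY1|rewrite (XYD X1 Y1)].
Qed.

End Delta.

Theorem theorem3 (G : groupType) (G_fp : finitely_presented G) :
  (forall g : G, g <> 1%g ->
     forall (X Y : ggraph G) (X1 : ncomp X = 1) (Y1 : ncomp Y = 1),
       gequiv X Y -> Delta g X1 = Delta g Y1) /\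
  (forall (X Y : ggraph G) (X1 : ncomp X = 1) (Y1 : ncomp Y = 1),
     gequiv X Y -> Delta_all X1 = Delta_all Y1).
Proof.
split=> [g /eqP g1 X Y X1 Y1 XY|X Y X1 Y1 XY].
  pose P := [pred x : G | (x == g) || (x == g^-1%g)].
  have P1 : ~~ P 1%g by rewrite /= !(eq_sym 1%g) invg_eq1 orbb.
  have PV x : P x^-1%g = P x by rewrite /= (inv_eq invgK) (inj_eq invg_inj) orbC.
  exact: (Delta_gequiv P1 PV XY).2.
have P1 : ~~ [pred x : G | x != 1%g] 1%g by rewrite /= eqxx.
have PV x : [pred x : G | x != 1%g] x^-1%g = [pred x : G | x != 1%g] x.
  by rewrite /= invg_eq1.
exact: (Delta_gequiv P1 PV XY).2.
Qed.
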